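(* Let $\Lambda$ be the $k$-algebra given by generators and relations in the context, and let $z_\lambda,z_\mu,z_\gamma,z_{\mu\lambda},z_{\gamma\lambda}\in\Lambda$ be the elements defined there. Then the centre $Z(\Lambda)$ has $k$-basis $$1,\ z_\lambda,\ z_\mu,\ z_\gamma,\ z_{\mu\lambda},\ z_{\gamma\lambda}.$$
   Context: Let $k$ be an algebraically closed field of characteristic $p>3$. Let $W=\{(p,0),(-p,p),(0,-p)\}$ and $-W=\{(-p,0),(p,-p),(0,p)\}$ in $\mathbb{Z}^2$. Let $\mathbb{K}=k e_\lambda\oplus k e_\gamma\oplus k e_\mu$ with $e_\lambda,e_\gamma,e_\mu$ orthogonal idempotents summing to $1$, and let $V$ be the 12-dimensional $\mathbb{K}$-bimodule with - $e_\lambda Ve_\gamma$ with basis $v_\alpha$ ($\alpha\in W$), $e_\gamma Ve_\lambda$ with basis $v_\alpha$ ($\alpha\in -W$), - $e_\mu Ve_\lambda$ with basis $w_\alpha$ ($\alpha\in W$), $e_\lambda Ve_\mu$ with basis $w_\alpha$ ($\alpha\in -W$), and all other $e_\sigma Ve_\tau=0$. Write $v_{i,j}=v_{(i,j)}$, $w_{i,j}=w_{(i,j)}$. Then $\Lambda=T_{\mathbb{K}}(V)/(R)$ where the relations are, for $\alpha,\beta\in -W$: - $v_\alpha v_{-\beta}=0$ for $\alpha\ne\beta$, and $v_\alpha v_{-\alpha}=v_\beta v_{-\beta}$ for all $\alpha,\beta$; - $w_{-\alpha}w_\beta=0$ for $\alpha\neq\beta$, and $w_{-\alpha}w_\alpha=w_{-\beta}w_\beta$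 for all $\alpha,\beta$; - $w_{-\alpha}v_{-\beta}+w_{-\beta}v_{-\alpha}=0$ for all $\alpha,\beta$; - $v_\alpha w_\beta+v_\beta w_\alpha=0$ for all $\alpha,\beta$; - $v_{-\alpha}v_\beta+w_\beta w_{-\alpha}=0$ for $\alpha\ne\beta$, and $v_{-\alpha}v_\alpha+w_\alpha w_{-\alpha}=v_{-\beta}v_\beta+w_\beta w_{-\beta}$ for all $\alpha,\beta$. ($\Lambda$ is the basic algebra of a non-semisimple singular block of the restricted enveloping algebra of $\mathfrak{sl}_3(k)$.) Put $\mathcal V=\sum_{\alpha\in W}v_\alpha v_{-\alpha}$, $\mathcal W=\sum_{\alpha\in W}w_{-\alpha}w_\alpha$ (both in $e_\lambda\Lambda e_\lambda$), and $$z_{\gamma\lambda}=3v_{0,p}v_{0,-p}-\mathcal V+2\mathcal W,\qquad z_{\mu\lambda}=3w_{0,-p}w_{0,p}-\mathcal W+2\mathcal V.$$ For $\alpha\in\{\lambda,\mu,\gamma\}$, $z_\alpha$ denotes a nonzero element spanning the (one-dimensional) socle of the left module $\Lambda e_\alpha$. *)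

(* Defs.v *)
From HB Require Import structures.
From mathcomp Require Import all_boot all_order all_algebra generic_quotient ring_quotient.
From mathcomp Require Import boolp.
From mathcomp Require Import finmap monalg.

Set Implicit Arguments.
Unset Strict Implicit.
Unset Printing Implicit Defensive.

Import GRing.Theory.
Local Open Scope ring_scope.
Local Open Scope quotient_scope.

Section FreeAlgebra.
Variables (k : comNzRingType) (X : choiceType).

Definition free_alg : Type := {malg k[{fmonom X}]}.
HB.instance Definition _ := GRing.Lalgebra.on free_alg.

Definition free_gen (x : X) : free_alg := << fmu x >>.

Fact free_alg_scaleAr (c : k) (x y : free_alg) : c *: (x * y) = x * (c *: y).
Proof.
have cC (z : free_alg) : c *: z = z * (c%:MP : free_alg).
  rewrite -mul_malgC (malgMEw msuppU_le (fsubset_refl _)) exchange_big.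
  rewrite (malgMEw (fsubset_refl _) msuppU_le).
  apply: eq_bigr => m _; rewrite !big_seq_fset1.
  by rewrite mcoeffUU mulrC mul1m mulm1.
by rewrite cC -mulrA -cC.
Qed.
HB.instance Definition _ := GRing.Lalgebra_isAlgebra.Build k free_alg
  free_alg_scaleAr.

Section Character.
Variable h : X -> k.

Definition free_mon_eval (m : {fmonom X}) : k := \prod_(x <- (m : seq X)) h x.

Fact free_mon_eval_mmorphism : mmorphism free_mon_eval.
Proof.
by split=> [x y|]; rewrite /free_mon_eval ?fm1 ?fmM ?big_nil ?big_cat.
Qed.
HB.instance Definition _ := monalg.isMultiplicative.Build _ _ free_mon_eval
  free_mon_eval_mmorphism.

Fact free_alg_character :
  exists chi : {rmorphism free_alg -> k}, forall x, chi (free_gen x) = h x.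
Proof.
exists (mmap idfun free_mon_eval : {malg _[_]} -> k) => x.
by rewrite /= mmapU mul1r /free_mon_eval fmU big_seq1.
Qed.

End Character.

End FreeAlgebra.

(* The two-sided ideal generated by the differences [l - r], for [rel l r]. *)
Inductive ideal_of (A : nzRingType) (rel : A -> A -> Prop) : A -> Prop :=
| ideal_of0 : ideal_of rel 0
| ideal_ofD a l r b x :
    rel l r -> ideal_of rel x -> ideal_of rel (a * (l - r) * b + x).

(* Properness is bundled because MathComp's algebras are nonzero rings. *)
Record proper_rel (A : nzRingType) := ProperRel {
  rel_of :> A -> A -> Prop;
  rel_proper : ~ ideal_of rel_of 1
}.

Section QuotientAlgebra.
Variables (k : comNzRingType) (A : algType k) (rel : proper_rel A).

Definition ideal_pred : {pred A} := fun x => `[< ideal_of rel x >].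

Let idealP x : reflect (ideal_of rel x) (x \in ideal_pred).
Proof. exact: asboolP. Qed.

Let idealD x y : ideal_of rel x -> ideal_of rel y -> ideal_of rel (x + y).
Proof.
move=> Ix Iy; elim: Ix => [|a l r b z lr _ IH]; first by rewrite add0r.
by rewrite -addrA; constructor.
Qed.

Let idealMl c x : ideal_of rel x -> ideal_of rel (c * x).
Proof.
elim=> [|a l r b z lr _ IH]; first by rewrite mulr0; constructor.
by rewrite mulrDr !mulrA; constructor.
Qed.

Let idealMr c x : ideal_of rel x -> ideal_of rel (x * c).
Proof.
elim=> [|a l r b z lr _ IH]; first by rewrite mul0r; constructor.
by rewrite mulrDl -mulrA; constructor.
Qed.

Fact ideal_zmod_closed : zmod_closed ideal_pred.
Proof.
split=> [|x y /idealP Ix /idealP Iy]; first by apply/idealP; constructor.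
by apply/idealP/idealD => //; rewrite -mulN1r; apply: idealMl.
Qed.
HB.instance Definition _ := GRing.isZmodClosed.Build A ideal_pred
  ideal_zmod_closed.

Definition quot_alg : Type := {ideal_quot ideal_pred}.
HB.instance Definition _ := Choice.on quot_alg.
HB.instance Definition _ := GRing.Zmodule.on quot_alg.

Definition quot_pi : A -> quot_alg := \pi_({ideal_quot ideal_pred}).

Definition quot_one : quot_alg := quot_pi 1.
Definition quot_mul : quot_alg -> quot_alg -> quot_alg :=
  lift_op2 {ideal_quot ideal_pred} *%R.
Definition quot_scale (c : k) : quot_alg -> quot_alg :=
  lift_op1 {ideal_quot ideal_pred} ( *:%R c).

Fact quot_piE x y : quot_pi x = quot_pi y <-> ideal_of rel (x - y).
Proof.
split=> [xy|Ixy]; last by apply/eqP; rewrite -Quotient.idealrBE; apply/idealP.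
by apply/idealP; rewrite Quotient.idealrBE; apply/eqP.
Qed.

Let piW (x : quot_alg) : {y | x = quot_pi y}.
Proof. by exists (repr (x : {ideal_quot ideal_pred})); rewrite /quot_pi reprK. Qed.

Let reprP y : ideal_of rel (repr (quot_pi y : {ideal_quot ideal_pred}) - y).
Proof. by apply/quot_piE; rewrite /quot_pi reprK. Qed.

Fact quot_piB x y : quot_pi (x - y) = quot_pi x - quot_pi y.
Proof. by rewrite /quot_pi [LHS]raddfB. Qed.

Fact quot_piM x y : quot_pi (x * y) = quot_mul (quot_pi x) (quot_pi y).
Proof.
apply/esym; rewrite /quot_mul; unlock; apply/quot_piE; set x' := repr _; set y' := repr _.
rewrite (_ : _ - _ = (x' - x) * y' + x * (y' - y)); last first.
  by rewrite mulrBl mulrBr addrA subrK.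
by apply: idealD; [apply/idealMr/reprP | apply/idealMl/reprP].
Qed.

Fact quot_piZ c x : quot_pi (c *: x) = quot_scale c (quot_pi x).
Proof.
apply/esym; rewrite /quot_scale; unlock; apply/quot_piE; rewrite -scalerBr -[_ - _]mul1r scalerAl.
exact/idealMl/reprP.
Qed.

Fact quot_piD x y : quot_pi (x + y) = quot_pi x + quot_pi y.
Proof. by rewrite /quot_pi [LHS]raddfD. Qed.

Fact quot_mulA : associative quot_mul.
Proof.
move=> x y z; have [x' ->] := piW x; have [y' ->] := piW y.
by have [z' ->] := piW z; rewrite -!quot_piM mulrA.
Qed.
Fact quot_mul1 : left_id quot_one quot_mul.
Proof. by move=> x; have [x' ->] := piW x; rewrite -quot_piM mul1r. Qed.
Fact quot_mulr1 : right_id quot_one quot_mul.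
Proof. by move=> x; have [x' ->] := piW x; rewrite -quot_piM mulr1. Qed.
Fact quot_mulDl : left_distributive quot_mul +%R.
Proof.
move=> x y z; have [x' ->] := piW x; have [y' ->] := piW y.
by have [z' ->] := piW z; rewrite -quot_piD -!quot_piM mulrDl quot_piD.
Qed.
Fact quot_mulDr : right_distributive quot_mul +%R.
Proof.
move=> x y z; have [x' ->] := piW x; have [y' ->] := piW y.
by have [z' ->] := piW z; rewrite -quot_piD -!quot_piM mulrDr quot_piD.
Qed.
Fact quot_one_neq0 : quot_one != 0.
Proof.
apply/eqP => h; apply: (rel_proper (p := rel)); rewrite -[1]subr0.
by apply/quot_piE; rewrite -/quot_one h /quot_pi [RHS]raddf0.
Qed.
HB.instance Definition _ := GRing.Zmodule_isNzRing.Build quot_alg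
  quot_mulA quot_mul1 quot_mulr1 quot_mulDl quot_mulDr quot_one_neq0.

Fact quot_scaleA a b x : quot_scale a (quot_scale b x) = quot_scale (a * b) x.
Proof. by have [x' ->] := piW x; rewrite -!quot_piZ scalerA. Qed.
Fact quot_scale1 : left_id 1 quot_scale.
Proof. by move=> x; have [x' ->] := piW x; rewrite -!quot_piZ scale1r. Qed.
Fact quot_scaleDr : right_distributive quot_scale +%R.
Proof.
move=> c x y; have [x' ->] := piW x; have [y' ->] := piW y.
by rewrite -quot_piD -!quot_piZ scalerDr quot_piD.
Qed.
Fact quot_scaleDl x : {morph quot_scale^~ x : a b / a + b}.
Proof.
by move=> a b; have [x' ->] := piW x; rewrite -!quot_piZ scalerDl quot_piD.
Qed.
HB.instance Definition _ := GRing.Zmodule_isLmodule.Build k quot_alg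
  quot_scaleA quot_scale1 quot_scaleDr quot_scaleDl.

Fact quot_scaleAl c (x y : quot_alg) : c *: (x * y) = (c *: x) * y.
Proof.
have [x' ->] := piW x; have [y' ->] := piW y.
rewrite -[LHS]/(quot_scale c (quot_mul (quot_pi x') (quot_pi y'))).
by rewrite -quot_piM -quot_piZ scalerAl quot_piM quot_piZ.
Qed.
HB.instance Definition _ := GRing.Lmodule_isLalgebra.Build k quot_alg
  quot_scaleAl.

Fact quot_scaleAr c (x y : quot_alg) : c *: (x * y) = x * (c *: y).
Proof.
have [x' ->] := piW x; have [y' ->] := piW y.
rewrite -[LHS]/(quot_scale c (quot_mul (quot_pi x') (quot_pi y'))).
by rewrite -quot_piM -quot_piZ scalerAr quot_piM quot_piZ.
Qed.
HB.instance Definition _ := GRing.Lalgebra_isAlgebra.Build k quot_alg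
  quot_scaleAr.

Fact quot_pi_monoid_morphism : monoid_morphism quot_pi.
Proof. by split=> // x y; rewrite quot_piM. Qed.
Fact quot_pi_scalable : scalable quot_pi.
Proof. by move=> c x; rewrite quot_piZ. Qed.
HB.instance Definition _ := GRing.isZmodMorphism.Build A quot_alg quot_pi
  quot_piB.
HB.instance Definition _ := GRing.isMonoidMorphism.Build A quot_alg quot_pi
  quot_pi_monoid_morphism.
HB.instance Definition _ := GRing.isScalable.Build k A quot_alg *:%R quot_pi
  quot_pi_scalable.

End QuotientAlgebra.

Inductive vertex := lam | gam | mu.

Definition vertex_code (s : vertex) : 'I_3 :=
  match s with lam => inord 0 | gam => inord 1 | mu => inord 2 end.
Definition vertex_decode (i : 'I_3) : vertex := nth lam [:: lam; gam; mu] i.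
Fact vertex_codeK : cancel vertex_code vertex_decode.
Proof. by case; rewrite /vertex_decode /= inordK. Qed.
HB.instance Definition _ := Finite.copy vertex (can_type vertex_codeK).

Definition W (p : nat) : seq (int * int) :=
  [:: (p%:Z, 0); (- p%:Z, p%:Z); (0, - p%:Z)].
Definition oppW (p : nat) : seq (int * int) :=
  [:: (- p%:Z, 0); (p%:Z, - p%:Z); (0, p%:Z)].

Definition wt (p : nat) : Type := {a : int * int | a \in W p ++ oppW p}.
HB.instance Definition _ p := Choice.on (wt p).

(* [e_s], [v_a] and [w_a] respectively. *)
Definition gen (p : nat) : Type := (vertex + (wt p + wt p))%type.
HB.instance Definition _ p := Choice.on (gen p).

(* The defining relations of Lambda between elements [e s], [v a], [w a] of a
   ring.  The first six constructors present the tensor algebra T_K(V): the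
   [e s] are orthogonal idempotents with sum 1, and the arrows lie in the
   prescribed [e s * V * e t].  The remaining ones are the relations R. *)
Section Relations.
Variables (p : nat) (A : nzRingType).
Variables (e : vertex -> A) (v w : int * int -> A).
Local Notation W := (W p).
Local Notation oppW := (oppW p).

Inductive Lambda_rel : A -> A -> Prop :=
| rel_idem s t : Lambda_rel (e s * e t) (if s == t then e s else 0)
| rel_unit : Lambda_rel (e lam + e gam + e mu) 1
| rel_v_W a : a \in W -> Lambda_rel (e lam * v a * e gam) (v a)
| rel_v_oppW a : a \in oppW -> Lambda_rel (e gam * v a * e lam) (v a)
| rel_w_W a : a \in W -> Lambda_rel (e mu * w a * e lam) (w a)
| rel_w_oppW a : a \in oppW -> Lambda_rel (e lam * w a * e mu) (w a)
| rel_vv0 a b : a \in oppW -> b \in oppW -> a != b ->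
    Lambda_rel (v a * v (- b)) 0
| rel_vv a b : a \in oppW -> b \in oppW ->
    Lambda_rel (v a * v (- a)) (v b * v (- b))
| rel_ww0 a b : a \in oppW -> b \in oppW -> a != b ->
    Lambda_rel (w (- a) * w b) 0
| rel_ww a b : a \in oppW -> b \in oppW ->
    Lambda_rel (w (- a) * w a) (w (- b) * w b)
| rel_wv a b : a \in oppW -> b \in oppW ->
    Lambda_rel (w (- a) * v (- b) + w (- b) * v (- a)) 0
| rel_vw a b : a \in oppW -> b \in oppW ->
    Lambda_rel (v a * w b + v b * w a) 0
| rel_vvww0 a b : a \in oppW -> b \in oppW -> a != b ->
    Lambda_rel (v (- a) * v b + w b * w (- a)) 0
| rel_vvww a b : a \in oppW -> b \in oppW ->
    Lambda_rel (v (- a) * v a + w a * w (- a))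
               (v (- b) * v b + w b * w (- b)).

Fact Lambda_rel_not1 (k : fieldType) (chi : {rmorphism A -> k}) :
    (forall s, chi (e s) = if s is lam then 1 else 0) ->
    (forall a, chi (v a) = 0) -> (forall a, chi (w a) = 0) ->
  ~ ideal_of Lambda_rel 1.
Proof.
move=> chiE chiV chiW.
have chi_rel l r : Lambda_rel l r -> chi l = chi r.
  case=> [s t||a _|a _|a _|a _|a b _ _ _|a b _ _|a b _ _ _|a b _ _|a b _ _
         |a b _ _|a b _ _ _|a b _ _];
    rewrite ?(rmorphD, rmorphM, rmorph0, rmorph1) ?(chiV, chiW);
    rewrite ?(mulr0, mul0r, addr0) //.
  - rewrite !chiE; case: eqVneq => [<-|].
      by rewrite chiE; case: s; rewrite ?mulr1 ?mulr0.
    by rewrite rmorph0; case: s t => [] []; rewrite ?eqxx ?mulr0 ?mul0r.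
  - by rewrite !chiE !addr0.
have chi_ideal x : ideal_of Lambda_rel x -> chi x = 0.
  elim=> [|a l r b y lr _ IH]; first exact: rmorph0.
  rewrite rmorphD !rmorphM rmorphB (chi_rel l r) //.
  by rewrite subrr mulr0 mul0r add0r.
by move/chi_ideal/eqP; rewrite rmorph1 oner_eq0.
Qed.

End Relations.

Section Presentation.
Variables (k : fieldType) (p : nat).
Local Notation F := (free_alg k (gen p)).

Definition gen_e (s : vertex) : F := free_gen k (inl s : gen p).
(* [gen_v a] and [gen_w a] take the junk value 0 when [a] is outside W and -W;
   they are only ever used for [a] in W or -W. *)
Definition gen_v (a : int * int) : F :=
  if insub a is Some i then free_gen k (inr (inl i) : gen p) else 0.
Definition gen_w (a : int * int) : F :=
  if insub a is Some i then free_gen k (inr (inr i) : gen p) else 0.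

Fact Lambda_rel_proper : ~ ideal_of (Lambda_rel p gen_e gen_v gen_w) 1.
Proof.
have [chi chiG] := free_alg_character
  (fun x : gen p => if x is inl lam then 1 else 0 : k).
apply: (@Lambda_rel_not1 _ _ _ _ _ k chi) => [s|a|a].
- by rewrite chiG; case: s.
- by rewrite /gen_v; case: insub => [i|]; rewrite ?chiG ?rmorph0.
- by rewrite /gen_w; case: insub => [i|]; rewrite ?chiG ?rmorph0.
Qed.

Definition Lambda : Type := quot_alg (ProperRel Lambda_rel_proper).
HB.instance Definition _ := GRing.Algebra.on Lambda.

Definition e (s : vertex) : Lambda := quot_pi _ (gen_e s).
Definition v (a : int * int) : Lambda := quot_pi _ (gen_v a).
Definition w (a : int * int) : Lambda := quot_pi _ (gen_w a).

Definition sumV : Lambda := \sum_(a <- W p) v a * v (- a).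
Definition sumW : Lambda := \sum_(a <- W p) w (- a) * w a.

Definition z_gamlam : Lambda :=
  3%:R *: (v (0, p%:Z) * v (0, - p%:Z)) - sumV + 2%:R *: sumW.
Definition z_mulam : Lambda :=
  3%:R *: (w (0, - p%:Z) * w (0, p%:Z)) - sumW + 2%:R *: sumV.

End Presentation.

Arguments e {k p}.

Section Socle.
Variables (R : nzRingType) (U : lmodType R).
Implicit Types M S T : U -> Prop.

Definition subset_of S T := forall x, S x -> T x.

Definition submodule S :=
  S 0 /\ forall (a : R) (x y : U), S x -> S y -> S (a *: x + y).

Definition simple_submodule S :=
  [/\ submodule S, exists2 x, S x & x != 0 &
      forall T, submodule T -> subset_of T S ->
        (forall x, T x -> x = 0) \/ subset_of S T].

(* The sum of the simple submodules of [M]. *)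
Definition socle M (x : U) := exists2 s : seq U,
  (forall y, y \in s ->
     exists S, [/\ simple_submodule S, subset_of S M & S y]) &
  x = \sum_(y <- s) y.

End Socle.

(* The left ideal [A a], as a submodule of the regular left module [A^o]. *)
Definition left_ideal (A : nzRingType) (a : A) : A^o -> Prop :=
  fun x => exists y : A, x = y * a.

Definition spans_socle (k : fieldType) (A : algType k) (a z : A) :=
  z != 0 /\
  forall x : A, socle (left_ideal a) x <-> exists c : k, x = c *: z.

Definition center (A : nzRingType) (z : A) : Prop :=
  forall x : A, z * x = x * z.

Definition is_basis (k : fieldType) (U : lmodType k) (S : U -> Prop) (n : nat)
    (b : n.-tuple U) :=
  [/\ forall i, S (tnth b i),
      forall c : 'I_n -> k,
        \sum_(i < n) c i *: tnth b i = 0 -> forall i, c i = 0 &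
      forall x, S x ->
        exists c : 'I_n -> k, x = \sum_(i < n) c i *: tnth b i].

(* Main.v *)
Require Import Defs.
From HB Require Import structures.
From mathcomp Require Import all_boot all_order all_algebra.
From mathcomp Require Import generic_quotient ring_quotient finmap monalg.
From mathcomp Require Import ssrAC ring boolp.

(** Number the elements of W from 0 to 2 and write V_i, v_i, W_i, w_i for the
    generators v_a, v_(-a), w_a, w_(-a) attached to the i-th element a.  The
    relations become
      v_i V_j = [i = j] tau,   W_i w_j = [i = j] sigma,
      V_i v_j + w_j W_i = [i = j] kappa,
    with W_i V_j and v_i w_j alternating in i and j.  They are symmetric under
    the exchange of gam with mu, V with w, v with W ([relations_swap]), which
    halves the work.

    Products of arrows simplify quickly.  The element kappa passes an arrow by
    turning into tau or sigma, and, there being a third index available,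
    V_i tau v_j = [i = j] T with T independent of i ([mulVtv]).  Hence all arrows
    kill T, tau^2 and sigma^2, and the column of each vertex is spanned by a
    short list of products of degree at most 4 ([columnG], [columnL]).  In
    particular the corner at gam is spanned by 1, tau, tau^2 and the corner at
    lam by 1, the V_i v_j, kappa and T.

    A central element z is the sum of its three corners, and commuting with V_l
    and w_l compares the corner at lam with the other two.  As tau and tau^2 are
    linearly independent, the matrix of coefficients of the V_i v_j must be
    scalar, the coefficients of 1 agree, and the coefficients g of tau and h of
    sigma determine the rest of the degree 2 part ([center_span]).  What is left
    is spanned by 1, T, tau^2, sigma^2 and the two elements
    tau + 2 kappa - sum V_i v_i and its mirror image, which are central and
    which are a third of z_gamlam and of z_mulam.

    Two facts of nonvanishing remain.  That tau^2 is not 0 is seen on an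
    explicit module of dimension 12 ([model]); by symmetry sigma^2 is not 0.
    That T is not 0 follows from the socle at lam being a line: otherwise
    tau v_0 and tau v_1 would both span it ([socL_neq0]).  Then T, tau^2 and
    sigma^2 are killed by all arrows, so they span the three socles, and the
    given z_lam, z_gam, z_mu are nonzero multiples of them. *)

Import GRing.Theory.
Set Implicit Arguments.
Unset Strict Implicit.
Unset Printing Implicit Defensive.
Local Open Scope ring_scope.

(** * The relations and their symmetry *)

(** [aV i], [av i], [aW i], [aw i] stand for v_a, v_{-a}, w_a, w_{-a},
    where a is the i-th element of W.  [tau], [sigma] and [kappa] are the
    common values of v_{-a}v_a, of w_aw_{-a} and of
    v_av_{-a} + w_{-a}w_a, one at each vertex. *)
Record arrows (A : Type) := Arrows {
  idem : vertex -> A;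
  aV : 'I_3 -> A; av : 'I_3 -> A; aW : 'I_3 -> A; aw : 'I_3 -> A;
  tau : A; sigma : A; kappa : A }.

Section Blocks.
Variables (A : nzRingType) (D : arrows A).

Definition in_block (r s : vertex) (x : A) := idem D r * x = x /\ x * idem D s = x.

(** The relations of Lambda with the weights replaced by indices.  Naming the
    common values lets a family of equalities between two instances be used as
    a rewrite rule. *)
Record relations : Prop := Relations {
  idem_mul : forall r s, idem D r * idem D s = if r == s then idem D r else 0;
  idem_sum : idem D lam + idem D gam + idem D mu = 1;
  blockV : forall i, in_block lam gam (aV D i);
  blockv : forall i, in_block gam lam (av D i);
  blockW : forall i, in_block mu lam (aW D i);
  blockw : forall i, in_block lam mu (aw D i);
  mulvV : forall i j, av D i * aV D j = if i == j then tau D else 0;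
  mulWw : forall i j, aW D i * aw D j = if i == j then sigma D else 0;
  anti_WV : forall i j, aW D i * aV D j = - (aW D j * aV D i);
  anti_vw : forall i j, av D i * aw D j = - (av D j * aw D i);
  addVv_wW : forall i j,
    aV D i * av D j + aw D j * aW D i = if i == j then kappa D else 0 }.

Lemma block_mul r s q x y : in_block r s x -> in_block s q y -> in_block r q (x * y).
Proof. by move=> [rx _] [_ yq]; split; rewrite ?mulrA ?rx // -mulrA yq. Qed.

Lemma block_add r s x y : in_block r s x -> in_block r s y -> in_block r s (x + y).
Proof.
by move=> [rx xs] [ry ys]; split; rewrite ?(mulrDr, mulrDl) ?rx ?xs ?ry ?ys.
Qed.

Lemma block_sum r s (F : 'I_3 -> A) :
  (forall i, in_block r s (F i)) -> in_block r s (\sum_i F i).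
Proof.
move=> Fb; elim/big_ind: _ => //; first by rewrite /in_block mulr0 mul0r.
by move=> *; apply: block_add.
Qed.

Hypothesis H : relations.

Lemma mul_block0 r s s' q x y :
  in_block r s x -> in_block s' q y -> s != s' -> x * y = 0.
Proof.
move=> [_ xs] [s'y _] ss'; rewrite -xs -s'y -mulrA [idem _ _ * (_ * _)]mulrA.
by rewrite (idem_mul H) (negPf ss') mul0r mulr0.
Qed.

Lemma block_idem r : in_block r r (idem D r).
Proof. by split; rewrite (idem_mul H) eqxx. Qed.

Lemma idem_block q r s x : in_block r s x -> idem D q * x = if q == r then x else 0.
Proof.
move=> xb; case: eqVneq => [->|qr]; first by case: xb.
exact: mul_block0 (block_idem q) xb qr.
Qed.

Lemma block_idemr q r s x : in_block r s x -> x * idem D q = if s == q then x else 0.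
Proof.
move=> xb; case: eqVneq => [<-|qr]; first by case: xb.
exact: mul_block0 xb (block_idem q) qr.
Qed.

Lemma block_tau : in_block gam gam (tau D).
Proof.
have := mulvV H 0 0; rewrite eqxx => <-.
exact: block_mul (blockv H _) (blockV H _).
Qed.

Lemma block_sigma : in_block mu mu (sigma D).
Proof.
have := mulWw H 0 0; rewrite eqxx => <-.
exact: block_mul (blockW H _) (blockw H _).
Qed.

Lemma block_kappa : in_block lam lam (kappa D).
Proof.
have := addVv_wW H 0 0; rewrite eqxx => <-.
by apply: block_add; [apply: block_mul (blockV H _) (blockv H _)
                     |apply: block_mul (blockw H _) (blockW H _)].
Qed.

End Blocks.

Definition swap_vertex (s : vertex) : vertex :=
  match s with lam => lam | gam => mu | mu => gam end.

Lemma swap_vertexK : involutive swap_vertex.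
Proof. by case. Qed.

(** Exchanging [gam] with [mu], V with w and v with W is a symmetry of the
    relations, so every statement about the vertex [gam] gives one about [mu]. *)
Definition swap (A : Type) (D : arrows A) : arrows A :=
  Arrows (idem D \o swap_vertex) (aw D) (aW D) (av D) (aV D)
         (sigma D) (tau D) (kappa D).

Lemma relations_swap (A : nzRingType) (D : arrows A) :
  relations D -> relations (swap D).
Proof.
case=> eM e1 bV bv bW bw vV Ww WV vw Vv; split=> //=.
- by move=> r s; rewrite eM (inj_eq (can_inj swap_vertexK)).
- by rewrite -e1 addrAC.
- by move=> i j; rewrite addrC eq_sym.
Qed.

(** Room for a third index is what makes the quartic relations work: they
    rewrite a product through an arrow of index different from those given. *)
Lemma ord3_third (i j : 'I_3) : exists l : 'I_3, (l != i) && (l != j).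
Proof.
by apply/existsP; case: i j => [[|[|[|i]]] Hi] // [[|[|[|j]]] Hj] //;
  apply/existsP; first [by exists (inord 0); rewrite -!val_eqE /= inordK
  | by exists (inord 1); rewrite -!val_eqE /= inordK
  | by exists (inord 2); rewrite -!val_eqE /= inordK].
Qed.

Inductive generator (A : nzRingType) (D : arrows A) : A -> Prop :=
| gen_idem s : generator D (idem D s)
| gen_aV i : generator D (aV D i)
| gen_av i : generator D (av D i)
| gen_aW i : generator D (aW D i)
| gen_aw i : generator D (aw D i).

Inductive lin_span (k : fieldType) (U : lmodType k) (B : U -> Prop) : U -> Prop :=
| span_0 : lin_span B 0
| span_D a b x : B b -> lin_span B x -> lin_span B (a *: b + x).

(** The elements [generator D] generate [A], phrased as an induction principle:
    a subspace containing 1 and stable under left multiplication by the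
    generators is everything. *)
Definition generated (k : fieldType) (A : algType k) (D : arrows A) :=
  forall P : A -> Prop, P 1 ->
    (forall a x y, P x -> P y -> P (a *: x + y)) ->
    (forall g x, generator D g -> P x -> P (g * x)) -> forall x, P x.

Section Span.
Variables (k : fieldType) (A : algType k) (B : A -> Prop).

Lemma span_lin a x y : lin_span B x -> lin_span B y -> lin_span B (a *: x + y).
Proof.
move=> Bx By; elim: Bx => [|b' b z Bb _ IH]; first by rewrite scaler0 add0r.
by rewrite scalerDr scalerA -addrA; apply: span_D.
Qed.

Lemma span_base b : B b -> lin_span B b.
Proof. by move=> Bb; rewrite -[b]scale1r -[X in lin_span B X]addr0; apply/span_D/span_0. Qed.

Lemma span_add x y : lin_span B x -> lin_span B y -> lin_span B (x + y).
Proof. by move=> Bx By; rewrite -[x]scale1r; apply: span_lin. Qed.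

Lemma span_opp x : lin_span B x -> lin_span B (- x).
Proof.
by move=> Bx; rewrite -scaleN1r -[X in lin_span B X]addr0; apply/span_lin/span_0.
Qed.

Lemma span_if (c : bool) x : lin_span B x -> lin_span B (if c then x else 0).
Proof. by case: c => // _; constructor. Qed.

Lemma span_mul g x :
  (forall b, B b -> lin_span B (g * b)) -> lin_span B x -> lin_span B (g * x).
Proof.
move=> gB; elim=> [|a b z Bb _ IH]; first by rewrite mulr0; constructor.
by rewrite mulrDr -scalerAr; apply: span_lin => //; apply: gB.
Qed.

End Span.

Lemma generated_swap (k : fieldType) (A : algType k) (D : arrows A) :
  generated D -> generated (swap D).
Proof.
move=> genD P P1 Plin Pgen; apply: genD => // _ x [s|i|i|i|i] Px; apply: Pgen => //.
- by rewrite (_ : idem D s = idem (swap D) (swap_vertex s)); [constructor | case: s].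
- exact: (gen_aw (swap D)).
- exact: (gen_aW (swap D)).
- exact: (gen_av (swap D)).
- exact: (gen_aV (swap D)).
Qed.

(** * Products of three and four arrows *)

Section Cubic.
Variables (k : fieldType) (A : algType k) (D : arrows A).
Hypotheses (two_neq0 : 2%:R != 0 :> k) (H : relations D).

Local Notation V := (aV D).
Local Notation v := (av D).
Local Notation W := (aW D).
Local Notation w := (aw D).
Local Notation t := (tau D).
Local Notation c := (kappa D).

Lemma eq_oppr0 (x : A) : x = - x -> x = 0.
Proof.
move=> xN; apply/eqP; suff: 2%:R *: x == 0 by rewrite scaler_eq0 (negPf two_neq0).
by rewrite scaler_nat mulr2n {2}xN subrr.
Qed.

Lemma mulWV0 i : W i * V i = 0.
Proof. exact/eq_oppr0/anti_WV. Qed.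

Lemma mulvw0 i : v i * w i = 0.
Proof. exact/eq_oppr0/anti_vw. Qed.

Lemma mulwW i j : w j * W i = (if i == j then c else 0) - V i * v j.
Proof. by rewrite -(addVv_wW H) addrAC subrr add0r. Qed.

(** Expand [kappa] with the index [i] of the arrow: one of its two terms dies on
    the arrow because [v i * w i = 0]. *)
Lemma mulv_kappa i : v i * c = t * v i.
Proof.
have := addVv_wW H i i; rewrite eqxx => <-.
by rewrite mulrDr !mulrA (mulvV H) eqxx mulvw0 mul0r addr0.
Qed.

Lemma mulkappa_V i : c * V i = V i * t.
Proof.
have := addVv_wW H i i; rewrite eqxx => <-.
by rewrite mulrDl -!mulrA (mulvV H) eqxx mulWV0 mulr0 addr0.
Qed.

Lemma mulvwW i l j :
  v i * w l * W j = (if j == l then t * v i else 0) - (if i == j then t * v l else 0).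
Proof.
rewrite -mulrA mulwW mulrBr mulrA (mulvV H).
by case: (j == l); case: (i == j); rewrite ?mul0r ?mulr0 ?mulv_kappa.
Qed.

Lemma mulwWV i l j :
  w i * W j * V l = (if i == j then V l * t else 0) - (if i == l then V j * t else 0).
Proof.
rewrite mulwW mulrBl -mulrA (mulvV H) [j == i]eq_sym.
by case: (i == j); case: (i == l); rewrite ?mul0r ?mulr0 ?mulkappa_V.
Qed.

Lemma mulVvV i j l : V i * v j * V l = if j == l then V i * t else 0.
Proof. by rewrite -mulrA (mulvV H); case: ifP; rewrite ?mulr0. Qed.

Lemma mulvVv i j l : v i * (V j * v l) = if i == j then t * v l else 0.
Proof. by rewrite mulrA (mulvV H); case: ifP; rewrite ?mul0r. Qed.

End Cubic.

Section Quartic.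
Variables (k : fieldType) (A : algType k) (D : arrows A).
Hypotheses (two_neq0 : 2%:R != 0 :> k) (H : relations D).

Local Notation V := (aV D).
Local Notation v := (av D).
Local Notation W := (aW D).
Local Notation w := (aw D).
Local Notation t := (tau D).
Local Notation s := (sigma D).
Local Notation c := (kappa D).

Let H' := relations_swap H.

Lemma mulW_kappa i : W i * c = s * W i.
Proof. exact: (mulv_kappa two_neq0 H'). Qed.

Lemma mulkappa_w i : c * w i = w i * s.
Proof. exact: (mulkappa_V two_neq0 H'). Qed.

Lemma mulWVv i j l :
  W i * (V j * v l) = (if j == l then s * W i else 0) - (if i == l then s * W j else 0).
Proof.
rewrite -[V j * v l](addrK (w l * W j)) (addVv_wW H) mulrBr mulrA (mulWw H).
by case: (j == l); case: (i == l); rewrite ?mulr0 ?mul0r ?mulW_kappa.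
Qed.

(** [sigma] is [W j * w j] and [v i * w j * W j] is [tau * v i]; the latter is
    also [v i * w l * W l] for a third index [l], and [W l * w j = 0]. *)
Lemma mulvw_sigma i j : v i * w j * s = 0.
Proof.
have [l /andP[li lj]] := ord3_third i j.
have [->|ij] := eqVneq i j; first by rewrite (mulvw0 two_neq0 H) mul0r.
have := mulWw H j j; rewrite eqxx => <-.
rewrite mulrA (mulvwW two_neq0 H) eqxx (negPf ij) subr0.
have <- : v i * w l * W l = t * v i.
  by rewrite (mulvwW two_neq0 H) eqxx [i == l]eq_sym (negPf li) subr0.
by rewrite -mulrA (mulWw H) (negPf lj) mulr0.
Qed.

(** A third index [l] gives [tau * v j = - v l * w j * W l], and then
    [V i * v l = - w l * W i]. *)
Lemma mulVtv_third i j l : l != i -> l != j ->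
  V i * t * v j = if i == j then w l * s * W l else 0.
Proof.
move=> li lj; have -> : V i * t * v j = - (V i * v l * w j * W l).
  rewrite -3!mulrA [v l * _]mulrA (mulvwW two_neq0 H) eqxx (negPf lj) sub0r.
  by rewrite mulrN opprK.
have /eqP := addVv_wW H i l; rewrite [i == l]eq_sym (negPf li) addr_eq0 => /eqP ->.
rewrite !mulNr opprK -[w l * W i * _]mulrA (mulWw H).
by case: (i == j); rewrite ?mulr0 ?mul0r.
Qed.

(** The element of top degree at the vertex [lam]; it will span the socle of the
    left ideal of [idem D lam]. *)
Definition socL : A := V 0 * t * v 0.

End Quartic.

Section Socle.
Variables (k : fieldType) (A : algType k) (D : arrows A).
Hypotheses (two_neq0 : 2%:R != 0 :> k) (H : relations D).

Local Notation V := (aV D).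
Local Notation v := (av D).
Local Notation t := (tau D).
Local Notation T := (socL D).

(** [V i * tau * v i] is [w l * sigma * W l] for every [l != i], which for a
    common [l] identifies the values at any two indices. *)
Lemma mulVtv i j : V i * t * v j = if i == j then T else 0.
Proof.
have [<-{j}|ij] := eqVneq i j; last first.
  have [l /andP[li lj]] := ord3_third i j.
  by rewrite (mulVtv_third two_neq0 H li lj) (negPf ij).
have [l /andP[li lj]] := ord3_third i 0.
by rewrite (mulVtv_third two_neq0 H li li) /socL (mulVtv_third two_neq0 H lj lj) !eqxx.
Qed.

Lemma socL_swap : socL (swap D) = T.
Proof.
have [l /andP[l0 _]] := ord3_third 0 0.
rewrite /socL /= -/(socL D).
have := mulVtv_third two_neq0 H (i := l) (j := l) (l := 0).
by rewrite eq_sym l0 eqxx mulVtv eqxx => ->.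
Qed.

Lemma block_socL : in_block D lam lam T.
Proof.
apply: block_mul (blockv H _); apply: block_mul (blockV H _) _.
exact: block_tau.
Qed.

(** Write [socL] as [V l * tau * v l] with [l != i]. *)
Lemma mulv_socL i : v i * T = 0.
Proof.
have [l /andP[li _]] := ord3_third i i.
have := mulVtv l l; rewrite eqxx => <-.
by rewrite !mulrA (mulvV H) eq_sym (negPf li) !mul0r.
Qed.

Lemma mulsocL_V i : T * V i = 0.
Proof.
have [l /andP[li _]] := ord3_third i i.
have := mulVtv l l; rewrite eqxx => <-.
by rewrite -mulrA (mulvV H) (negPf li) mulr0.
Qed.

Lemma mulVtt i : V i * t * t = 0.
Proof.
have := mulvV H 0 0; rewrite eqxx => {2}<-.
by rewrite mulrA mulVtv; case: ifP; rewrite ?mul0r ?mulsocL_V.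
Qed.

Lemma multtv i : t * t * v i = 0.
Proof.
have := mulvV H 0 0; rewrite eqxx => {1}<-.
by rewrite -!mulrA [V 0 * _]mulrA mulVtv; case: ifP; rewrite ?mulr0 ?mulv_socL.
Qed.

Lemma tau_cube : t * t * t = 0.
Proof.
have := mulvV H 0 0; rewrite eqxx => {3}<-.
by rewrite mulrA multtv mul0r.
Qed.

End Socle.

Section SocleMirror.
Variables (k : fieldType) (A : algType k) (D : arrows A).
Hypotheses (two_neq0 : 2%:R != 0 :> k) (H : relations D).

Let H' := relations_swap H.

Lemma mulwsW i j : aw D i * sigma D * aW D j = if i == j then socL D else 0.
Proof. by have := mulVtv two_neq0 H' i j; rewrite (socL_swap two_neq0 H). Qed.

Lemma mulW_socL i : aW D i * socL D = 0.
Proof. by have := mulv_socL two_neq0 H' i; rewrite (socL_swap two_neq0 H). Qed.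

Lemma mulsocL_w i : socL D * aw D i = 0.
Proof. by have := mulsocL_V two_neq0 H' i; rewrite (socL_swap two_neq0 H). Qed.

End SocleMirror.

(** * Spanning sets of the columns *)

Section Columns.
Variables (k : fieldType) (A : algType k) (D : arrows A).
Hypotheses (two_neq0 : 2%:R != 0 :> k) (H : relations D).

Local Notation V := (aV D).
Local Notation v := (av D).
Local Notation W := (aW D).
Local Notation t := (tau D).
Local Notation s := (sigma D).
Local Notation c := (kappa D).
Local Notation T := (socL D).

(** Products of increasing degree at a vertex.  The W i * V j, being alternating,
    are only three up to sign; [colL] has [kappa] in place of the w j * W i,
    which differ from multiples of it by - V i * v j. *)
Inductive colG : A -> Prop :=
| colG_idem : colG (idem D gam)
| colG_V i : colG (V i)
| colG_tau : colG t
| colG_WV i j : colG (W i * V j)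
| colG_Vtau i : colG (V i * t)
| colG_tautau : colG (t * t).

Inductive colL : A -> Prop :=
| colL_idem : colL (idem D lam)
| colL_v i : colL (v i)
| colL_W i : colL (W i)
| colL_Vv i j : colL (V i * v j)
| colL_kappa : colL c
| colL_tauv i : colL (t * v i)
| colL_sigmaW i : colL (s * W i)
| colL_socL : colL T.

Ltac block := repeat first
  [ exact: (blockV H) | exact: (blockv H) | exact: (blockW H) | exact: (blockw H)
  | exact: (block_tau H) | exact: (block_sigma H) | exact: (block_kappa H)
  | exact: (block_socL H) | exact: (block_idem H) | apply: block_mul].

Ltac mismatch :=
  match goal with |- lin_span _ ?x => rewrite (_ : x = 0); first exact: span_0 end;
  apply: (mul_block0 H); [block | block | by apply/eqP].

Lemma colG_block b : colG b -> exists r, in_block D r gam b.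
Proof.
case=> [|i||i j|i|]; [exists gam | exists lam | exists gam | exists mu
  | exists lam | exists gam]; block.
Qed.

Lemma colL_block b : colL b -> exists r, in_block D r lam b.
Proof.
case=> [|i|i|i j||i|i|]; [exists lam | exists gam | exists mu | exists lam
  | exists lam | exists gam | exists mu | exists lam]; block.
Qed.

Lemma colG_closed g b : generator D g -> colG b -> lin_span colG (g * b).
Proof.
case=> [q|i|i|i|i] Cb.
- have [r rb] := colG_block Cb; rewrite (idem_block H _ rb).
  exact/span_if/span_base.
- case: Cb => [|j||j l|j|]; try mismatch.
  + rewrite (proj2 (blockV H i)); exact/span_base/colG_V.
  + exact/span_base/colG_Vtau.
  + by rewrite mulrA (mulVtt two_neq0 H); constructor.
- case: Cb => [|j||j l|j|]; try mismatch.
  + rewrite (mulvV H); exact/span_if/span_base/colG_tau.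
  + rewrite mulrA (mulvV H); case: ifP => _; last by rewrite mul0r; constructor.
    exact/span_base/colG_tautau.
- case: Cb => [|j||j l|j|]; try mismatch.
  + exact/span_base/colG_WV.
  + rewrite mulrA (mulvw_sigma two_neq0 (relations_swap H)); constructor.
- case: Cb => [|j||j l|j|]; try mismatch.
  rewrite mulrA (mulwWV two_neq0 H); apply: span_add; last apply: span_opp;
    exact/span_if/span_base/colG_Vtau.
Qed.

Lemma colL_closed g b : generator D g -> colL b -> lin_span colL (g * b).
Proof.
case=> [q|i|i|i|i] Cb.
- have [r rb] := colL_block Cb; rewrite (idem_block H _ rb).
  exact/span_if/span_base.
- case: Cb => [|j|j|j l||j|j|]; try mismatch.
  + exact/span_base/colL_Vv.
  + rewrite mulrA (mulVtv two_neq0 H); exact/span_if/span_base/colL_socL.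
- case: Cb => [|j|j|j l||j|j|]; try mismatch.
  + rewrite (proj2 (blockv H i)); exact/span_base/colL_v.
  + rewrite (mulvVv H); exact/span_if/span_base/colL_tauv.
  + rewrite (mulv_kappa two_neq0 H); exact/span_base/colL_tauv.
  + rewrite (mulv_socL two_neq0 H); constructor.
- case: Cb => [|j|j|j l||j|j|]; try mismatch.
  + rewrite (proj2 (blockW H i)); exact/span_base/colL_W.
  + rewrite (mulWVv two_neq0 H); apply: span_add; last apply: span_opp;
      exact/span_if/span_base/colL_sigmaW.
  + rewrite (mulW_kappa two_neq0 H); exact/span_base/colL_sigmaW.
  + rewrite (mulW_socL two_neq0 H); constructor.
- case: Cb => [|j|j|j l||j|j|]; try mismatch.
  + rewrite (mulwW H); apply: span_add; last apply: span_opp.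
      exact/span_if/span_base/colL_kappa.
    exact/span_base/colL_Vv.
  + rewrite mulrA (mulwsW two_neq0 H); exact/span_if/span_base/colL_socL.
Qed.

Hypothesis genD : generated D.

Lemma columnG x : lin_span colG (x * idem D gam).
Proof.
move: x; apply: genD => [|a x y Cx Cy|g x Dg Cx].
- rewrite mul1r; exact/span_base/colG_idem.
- by rewrite mulrDl -scalerAl; apply: span_lin.
- by rewrite -mulrA; apply: span_mul => // b; apply: colG_closed.
Qed.

Lemma columnL x : lin_span colL (x * idem D lam).
Proof.
move: x; apply: genD => [|a x y Cx Cy|g x Dg Cx].
- rewrite mul1r; exact/span_base/colL_idem.
- by rewrite mulrDl -scalerAl; apply: span_lin.
- by rewrite -mulrA; apply: span_mul => // b; apply: colL_closed.
Qed.

(** Cutting the column on the left keeps only the elements of the family that begin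
    and end at the same vertex. *)
Lemma cornerG x : exists a g b,
  idem D gam * x * idem D gam = a *: idem D gam + g *: t + b *: (t * t).
Proof.
rewrite -mulrA; elim: (columnG x) => [|a b y Cb _ [a' [g' [b' IH]]]].
  by exists 0, 0, 0; rewrite mulr0 !scale0r !addr0.
suff [a1 [g1 [b1 E]]] : exists a g d,
    idem D gam * b = a *: idem D gam + g *: t + d *: (t * t).
  exists (a * a1 + a'), (a * g1 + g'), (a * b1 + b').
  rewrite mulrDr -scalerAr IH E !scalerDr !scalerDl !scalerA.
  by rewrite [LHS]addrACA; congr (_ + _); rewrite addrACA.
have zero r : in_block D r gam b -> gam != r -> exists a g d,
    idem D gam * b = a *: idem D gam + g *: t + d *: (t * t).
  move=> rb /negPf gr; exists 0, 0, 0.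
  by rewrite (idem_block H gam rb) gr !scale0r !addr0.
case: Cb zero => [|i||i j|i|] zero.
- by exists 1, 0, 0; rewrite (idem_mul H) eqxx scale1r !scale0r !addr0.
- by apply: (zero lam); [block | apply/eqP].
- exists 0, 1, 0; rewrite (idem_block H gam (block_tau H)) eqxx.
  by rewrite scale1r !scale0r add0r addr0.
- by apply: (zero mu); [block | apply/eqP].
- by apply: (zero lam); [block | apply/eqP].
- exists 0, 0, 1; rewrite mulrA (idem_block H gam (block_tau H)) eqxx.
  by rewrite scale1r !scale0r !add0r.
Qed.

Lemma cornerL x : exists a (m : 'I_3 -> 'I_3 -> k) d b,
  idem D lam * x * idem D lam =
    a *: idem D lam + \sum_i \sum_j m i j *: (V i * v j) + d *: c + b *: T.
Proof.
rewrite -mulrA; elim: (columnL x) => [|a b y Cb _ [a' [m' [d' [b' IH]]]]].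
  exists 0, (fun _ _ => 0), 0, 0; rewrite mulr0 !scale0r !addr0 big1 ?addr0 //.
  by move=> i _; rewrite big1 // => j _; rewrite scale0r.
suff [a1 [m1 [d1 [b1 E]]]] : exists a (m : 'I_3 -> 'I_3 -> k) d b', idem D lam * b =
    a *: idem D lam + \sum_i \sum_j m i j *: (V i * v j) + d *: c + b' *: T.
  exists (a * a1 + a'), (fun i j => a * m1 i j + m' i j), (a * d1 + d'), (a * b1 + b').
  rewrite mulrDr -scalerAr IH E !scalerDr.
  have -> : \sum_i \sum_j (a * m1 i j + m' i j) *: (V i * v j) =
      a *: (\sum_i \sum_j m1 i j *: (V i * v j)) + \sum_i \sum_j m' i j *: (V i * v j).
    rewrite scaler_sumr -big_split /=; apply: eq_bigr => i _.
    rewrite scaler_sumr -big_split /=; apply: eq_bigr => j _.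
    by rewrite scalerDl scalerA.
  rewrite !scalerDl !scalerA.
  by rewrite [LHS]addrACA; congr (_ + _); rewrite addrACA; congr (_ + _); rewrite addrACA.
have sum0 : \sum_(i : 'I_3) \sum_(j : 'I_3) (0 : k) *: (V i * v j) = 0.
  by rewrite big1 // => i _; rewrite big1 // => j _; rewrite scale0r.
have zero r : in_block D r lam b -> lam != r ->
    exists a (m : 'I_3 -> 'I_3 -> k) d b', idem D lam * b =
    a *: idem D lam + \sum_i \sum_j m i j *: (V i * v j) + d *: c + b' *: T.
  move=> rb /negPf lr; exists 0, (fun _ _ => 0), 0, 0.
  by rewrite (idem_block H lam rb) lr sum0 !scale0r !addr0.
case: Cb zero => [|i|i|i j||i|i|] zero.
- exists 1, (fun _ _ => 0), 0, 0.
  by rewrite (idem_mul H) eqxx sum0 scale1r !scale0r !addr0.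
- by apply: (zero gam); [block | apply/eqP].
- by apply: (zero mu); [block | apply/eqP].
- exists 0, (fun i' j' => ((i' == i) && (j' == j))%:R), 0, 0.
  rewrite mulrA (idem_block H lam (blockV H i)) eqxx.
  rewrite (bigD1 i) //= (bigD1 j) //= !eqxx scale1r !scale0r add0r !addr0.
  rewrite !big1 ?addr0 // => i' /negPf i'i; last by rewrite i'i scale0r.
  by rewrite big1 // => j' _; rewrite i'i scale0r.
- exists 0, (fun _ _ => 0), 1, 0; rewrite (idem_block H lam (block_kappa H)) eqxx.
  by rewrite sum0 scale1r !scale0r !add0r addr0.
- by apply: (zero gam); [block | apply/eqP].
- by apply: (zero mu); [block | apply/eqP].
- exists 0, (fun _ _ => 0), 0, 1; rewrite (idem_block H lam (block_socL H)) eqxx.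
  by rewrite sum0 scale1r !scale0r !add0r.
Qed.

End Columns.

(** * Central elements *)

Section CentralElement.
Variables (k : fieldType) (A : algType k) (D : arrows A).
Hypotheses (two_neq0 : 2%:R != 0 :> k) (H : relations D).

Local Notation V := (aV D).
Local Notation v := (av D).
Local Notation W := (aW D).
Local Notation w := (aw D).
Local Notation t := (tau D).
Local Notation s := (sigma D).
Local Notation c := (kappa D).

(** A third of [z_gamlam]: there [sumW] is [3 kappa - sumV].  The form used here
    makes sense, and is central, without dividing by 3; the symmetry carries it
    to a third of [z_mulam]. *)
Definition casimir : A := t + 2%:R *: c - \sum_i V i * v i.

Lemma center_generated z : generated D ->
  (forall g, generator D g -> z * g = g * z) -> center z.
Proof.
move=> genD zD; apply: genD => [|a x y zx zy|g x Dg zx]; first by rewrite mulr1 mul1r.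
  by rewrite mulrDr mulrDl -scalerAr -scalerAl zx zy.
by rewrite mulrA zD // -mulrA zx mulrA.
Qed.

Lemma idem_comm_block r q z : in_block D r r z -> z * idem D q = idem D q * z.
Proof. by move=> rz; rewrite (idem_block H q rz) (block_idemr H q rz) eq_sym. Qed.

Lemma sum_delta (x : A) (i : 'I_3) : \sum_j (if i == j then x else 0) = x.
Proof.
rewrite (bigD1 i) //= eqxx big1 ?addr0 // => j ji.
by rewrite eq_sym (negPf ji).
Qed.

Lemma mulv_sumVv i : v i * (\sum_j V j * v j) = t * v i.
Proof.
rewrite mulr_sumr -[RHS](sum_delta _ i); apply: eq_bigr => j _.
by rewrite (mulvVv H); case: eqP => [->|].
Qed.

Lemma mulsumVv_V i : (\sum_j V j * v j) * V i = V i * t.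
Proof.
rewrite mulr_suml -[RHS](sum_delta _ i); apply: eq_bigr => j _.
by rewrite (mulVvV H) eq_sym; case: eqP => [->|].
Qed.

(** Each of the three terms contributes [sigma * W i], except that the term of
    index [i] vanishes because [W i * V i = 0]. *)
Lemma mulW_sumVv i : W i * (\sum_j V j * v j) = 2%:R *: (s * W i).
Proof.
rewrite mulr_sumr (eq_bigr (fun j => s * W i - if i == j then s * W i else 0)).
  rewrite sumrB sum_delta sumr_const card_ord -scaler_nat -{2}[s * W i]scale1r.
  by rewrite -scalerBl mulrSr addrK.
by move=> j _; rewrite (mulWVv two_neq0 H) eqxx; case: eqP => [->|].
Qed.

Lemma mulsumVv_w i : (\sum_j V j * v j) * w i = 2%:R *: (w i * s).
Proof.
rewrite mulr_suml (eq_bigr (fun j => w i * s - if i == j then w i * s else 0)).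
  rewrite sumrB sum_delta sumr_const card_ord -scaler_nat -{2}[w i * s]scale1r.
  by rewrite -scalerBl mulrSr addrK.
move=> j _; rewrite -[V j * v j](addrK (w j * W j)) (addVv_wW H) eqxx mulrBl.
rewrite (mulkappa_w two_neq0 H) -mulrA (mulWw H) eq_sym.
by case: eqP => [->|]; rewrite ?mulr0.
Qed.

Lemma block_sumVv : in_block D lam lam (\sum_i V i * v i).
Proof. by apply: block_sum => i; apply: block_mul (blockV H i) (blockv H i). Qed.

Lemma block_scale r q a x : in_block D r q x -> in_block D r q (a *: x).
Proof. by move=> [rx xq]; split; rewrite -?scalerAr -?scalerAl ?rx ?xq. Qed.

Hypothesis genD : generated D.

(** At a V or v arrow, [2 kappa - sum V v] acts as [2 tau - tau], which matches
    the term [tau] on the other side; at a W or w arrow it acts as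
    [2 sigma - 2 sigma]. *)
Lemma casimir_central : center casimir.
Proof.
have bt := block_tau H; have bS := block_sumVv.
have bc := block_scale 2%:R (block_kappa H).
apply: center_generated genD _ => _ [q|i|i|i|i]; rewrite /casimir !mulrDl !mulrDr mulNr mulrN.
- by congr (_ + _ - _); try congr (_ + _);
    [apply: idem_comm_block bt | apply: idem_comm_block bc | apply: idem_comm_block bS].
- rewrite (mul_block0 H bt (blockV H i)); last by apply/eqP.
  rewrite (mul_block0 H (blockV H i) bc); last by apply/eqP.
  rewrite (mul_block0 H (blockV H i) bS); last by apply/eqP.
  rewrite mulsumVv_V -scalerAl (mulkappa_V two_neq0 H) scaler_nat mulr2n.
  by rewrite !(add0r, addr0, subr0) addrK.
- rewrite (mul_block0 H bc (blockv H i)); last by apply/eqP.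
  rewrite (mul_block0 H bS (blockv H i)); last by apply/eqP.
  rewrite (mul_block0 H (blockv H i) bt); last by apply/eqP.
  rewrite mulv_sumVv -scalerAr (mulv_kappa two_neq0 H) scaler_nat mulr2n.
  by rewrite !(add0r, addr0, subr0) addrK.
- rewrite (mul_block0 H bt (blockW H i)); last by apply/eqP.
  rewrite (mul_block0 H bc (blockW H i)); last by apply/eqP.
  rewrite (mul_block0 H bS (blockW H i)); last by apply/eqP.
  rewrite (mul_block0 H (blockW H i) bt); last by apply/eqP.
  by rewrite mulW_sumVv -scalerAr (mulW_kappa two_neq0 H) !(add0r, addr0, subr0) subrr.
- rewrite (mul_block0 H bt (blockw H i)); last by apply/eqP.
  rewrite (mul_block0 H (blockw H i) bt); last by apply/eqP.
  rewrite (mul_block0 H (blockw H i) bc); last by apply/eqP.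
  rewrite (mul_block0 H (blockw H i) bS); last by apply/eqP.
  by rewrite mulsumVv_w -scalerAl (mulkappa_w two_neq0 H) !(add0r, addr0, subr0) subrr.
Qed.

Lemma tautau_central : center (t * t).
Proof.
have bt := block_tau H; have btt := block_mul bt bt.
apply: center_generated genD _ => _ [q|i|i|i|i].
- exact: idem_comm_block btt.
- rewrite mulrA (mulVtt two_neq0 H).
  by apply: (mul_block0 H btt (blockV H i)); apply/eqP.
- rewrite (multtv two_neq0 H).
  by apply/esym/(mul_block0 H (blockv H i) btt); apply/eqP.
- rewrite (mul_block0 H btt (blockW H i)); last by apply/eqP.
  by rewrite (mul_block0 H (blockW H i) btt) //; apply/eqP.
- rewrite (mul_block0 H btt (blockw H i)); last by apply/eqP.
  by rewrite (mul_block0 H (blockw H i) btt) //; apply/eqP.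
Qed.

Lemma socL_central : center (socL D).
Proof.
have bT := block_socL H.
apply: center_generated genD _ => _ [q|i|i|i|i].
- exact: idem_comm_block bT.
- rewrite (mulsocL_V two_neq0 H).
  by apply/esym/(mul_block0 H (blockV H i) bT); apply/eqP.
- rewrite (mulv_socL two_neq0 H).
  by apply: (mul_block0 H bT (blockv H i)); apply/eqP.
- rewrite (mulW_socL two_neq0 H).
  by apply: (mul_block0 H bT (blockW H i)); apply/eqP.
- rewrite (mulsocL_w two_neq0 H).
  by apply/esym/(mul_block0 H (blockw H i) bT); apply/eqP.
Qed.

End CentralElement.

(** * The centre is no larger *)

Section UpperBound.
Variables (k : fieldType) (A : algType k) (D : arrows A).
Hypotheses (two_neq0 : 2%:R != 0 :> k) (H : relations D) (genD : generated D).
Hypotheses (tt_neq0 : tau D * tau D != 0) (ss_neq0 : sigma D * sigma D != 0).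

Local Notation V := (aV D).
Local Notation v := (av D).
Local Notation t := (tau D).
Local Notation c := (kappa D).
Local Notation T := (socL D).

Lemma free_tau a b : a *: t + b *: (t * t) = 0 -> a = 0 /\ b = 0.
Proof.
move=> ab0; have a0 : a = 0.
  have /eqP := congr1 (fun x => x * t) ab0.
  rewrite mulrDl -!scalerAl (tau_cube two_neq0 H) scaler0 addr0 mul0r scaler_eq0.
  by rewrite (negPf tt_neq0) orbF => /eqP.
split=> //; move/eqP: ab0; rewrite a0 scale0r add0r scaler_eq0.
by rewrite (negPf tt_neq0) orbF => /eqP.
Qed.

Lemma center_corner z q : center z -> idem D q * z * idem D q = z * idem D q.
Proof. by move=> zC; rewrite -zC -mulrA (idem_mul H) eqxx. Qed.

Lemma center_diag z : center z ->
  z = idem D lam * z * idem D lam + idem D gam * z * idem D gam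
      + idem D mu * z * idem D mu.
Proof. by move=> zC; rewrite !center_corner // -!mulrDr (idem_sum H) mulr1. Qed.

(** The corners of a central element determine each other through the arrows. *)
Lemma center_block z r q x : center z -> in_block D r q x ->
  (idem D r * z * idem D r) * x = x * (idem D q * z * idem D q).
Proof.
by move=> zC [rx xq]; rewrite !center_corner // -mulrA rx zC mulrA xq.
Qed.

Lemma mulmatrix_V (m : 'I_3 -> 'I_3 -> k) l :
  (\sum_i \sum_j m i j *: (V i * v j)) * V l = \sum_i m i l *: (V i * t).
Proof.
rewrite mulr_suml; apply: eq_bigr => i _; rewrite mulr_suml (bigD1 l) //=.
rewrite -scalerAl (mulVvV H) eqxx big1 ?addr0 // => j /negPf jl.
by rewrite -scalerAl (mulVvV H) jl scaler0.
Qed.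

Lemma mulv_column (x : 'I_3 -> k) i :
  v i * (\sum_j x j *: (V j * t)) = x i *: (t * t).
Proof.
rewrite mulr_sumr (bigD1 i) //= -scalerAr mulrA (mulvV H) eqxx.
rewrite big1 ?addr0 // => j ji.
by rewrite -scalerAr mulrA (mulvV H) eq_sym (negPf ji) mul0r scaler0.
Qed.

(** Multiplying [zL * V l = V l * zG] on the left by [v i] lands in the span of
    [tau] and [tau * tau], where coefficients can be compared: the matrix [m]
    must be scalar. *)
Lemma corner_V zL zG a m d b aG g bG l :
  zL = a *: idem D lam + \sum_i \sum_j m i j *: (V i * v j) + d *: c + b *: T ->
  zG = aG *: idem D gam + g *: t + bG *: (t * t) ->
  zL * V l = V l * zG ->
  a = aG /\ forall i, m i l = if i == l then g - d else 0.
Proof.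
move=> -> ->; rewrite !mulrDl !mulrDr -!scalerAl -!scalerAr mulmatrix_V.
rewrite (blockV H l).1 (blockV H l).2 (mulkappa_V two_neq0 H).
rewrite (mulsocL_V two_neq0 H) [V l * (t * t)]mulrA (mulVtt two_neq0 H) !scaler0 !addr0 => E.
have key i : (if i == l then a - aG else 0) *: t
    + (m i l - if i == l then g - d else 0) *: (t * t) = 0.
  have := congr1 (fun x => v i * x) E.
  rewrite !mulrDr mulv_column -!scalerAr [v i * (V l * t)]mulrA (mulvV H).
  case: (i == l); last by rewrite mul0r !scaler0 !addr0 add0r subr0 scale0r add0r.
  move/eqP; rewrite -subr_eq0 => /eqP <-; rewrite !scalerBl.
  rewrite opprB opprD !addrA; congr (_ - _); rewrite [RHS]addrAC; congr (_ + _).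
  by rewrite addrAC.
split=> [|i]; last by have [_ /eqP] := free_tau (key i); rewrite subr_eq0 => /eqP.
by have [+ _] := free_tau (key l); rewrite eqxx => /eqP; rewrite subr_eq0 => /eqP.
Qed.

Lemma sum_scalar_matrix d :
  \sum_i \sum_j (if i == j then d else 0) *: (V i * v j) = d *: \sum_i V i * v i.
Proof.
rewrite scaler_sumr; apply: eq_bigr => i _.
rewrite -[RHS](sum_delta _ i); apply: eq_bigr => j _.
by case: eqP => [->|]; rewrite ?scale0r.
Qed.

End UpperBound.

Section Center.
Variables (k : fieldType) (A : algType k) (D : arrows A).
Hypotheses (two_neq0 : 2%:R != 0 :> k) (H : relations D) (genD : generated D).
Hypotheses (tt_neq0 : tau D * tau D != 0) (ss_neq0 : sigma D * sigma D != 0).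

Local Notation V := (aV D).
Local Notation v := (av D).
Local Notation W := (aW D).
Local Notation w := (aw D).
Local Notation t := (tau D).
Local Notation s := (sigma D).
Local Notation c := (kappa D).
Local Notation T := (socL D).

Lemma sumwW : \sum_i w i * W i = 3%:R *: c - \sum_i V i * v i.
Proof.
rewrite (eq_bigr (fun i => c - V i * v i)) => [|i _].
  by rewrite sumrB sumr_const card_ord scaler_nat.
by rewrite (mulwW H) eqxx.
Qed.

Lemma casimir_swap : casimir (swap D) = s - c + \sum_i V i * v i.
Proof.
rewrite /casimir /= sumwW !scaler_nat [c *+ 3]mulrSr.
rewrite opprB addrA opprD addrA [s + c *+ 2 + _]addrAC.
by rewrite addrK addrAC.
Qed.

(** The same comparison at the vertex [mu], now that the matrix part of [zL] is a
    multiple [u] of [sum V v]; on [w l] that sum acts as [2 sigma]. *)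
Lemma corner_w zL zM a u d b aM h bM l :
  zL = a *: idem D lam + u *: (\sum_i V i * v i) + d *: c + b *: T ->
  zM = aM *: idem D mu + h *: s + bM *: (s * s) ->
  zL * w l = w l * zM ->
  a = aM /\ h = u *+ 2 + d.
Proof.
move=> -> ->; rewrite !mulrDl !mulrDr -!scalerAl -!scalerAr (mulsumVv_w two_neq0 H).
rewrite (blockw H l).1 (blockw H l).2 (mulkappa_w two_neq0 H) scalerA mulr_natr.
rewrite (mulsocL_w two_neq0 H) [w l * (s * s)]mulrA.
rewrite (mulVtt two_neq0 (relations_swap H)) !scaler0 !addr0 => E.
have key : (a - aM) *: s + (u *+ 2 + d - h) *: (s * s) = 0.
  have /eqP := congr1 (fun x => W l * x) E.
  rewrite !mulrDr -!scalerAr [W l * (w l * s)]mulrA (mulWw H) eqxx -subr_eq0.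
  move=> /eqP <-; rewrite !scalerBl scalerDl opprD !addrA.
  by congr (_ - _); rewrite [RHS]addrAC; congr (_ + _); rewrite addrAC.
have [/eqP + /eqP] := free_tau two_neq0 (relations_swap H) ss_neq0 key.
by rewrite !subr_eq0 => /eqP -> /eqP.
Qed.

Lemma center_span z : center z -> exists a g h bL bG bM,
  z = a *: 1 + g *: casimir D + h *: casimir (swap D)
      + bL *: T + bG *: (t * t) + bM *: (s * s).
Proof.
move=> zC; have H' := relations_swap H.
have [a [m [d [b zL]]]] := cornerL two_neq0 H genD z.
have [aG [g [bG zG]]] := cornerG two_neq0 H genD z.
have [aM [h [bM]]] := cornerG two_neq0 H' (generated_swap genD) z.
rewrite /= => zM.
have cornV l := corner_V two_neq0 H tt_neq0 zL zG (center_block H zC (blockV H l)).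
have [aGE _] := cornV 0.
have mE i j : m i j = if i == j then g - d else 0 by case: (cornV j).
have zL' : idem D lam * z * idem D lam =
    a *: idem D lam + (g - d) *: (\sum_i V i * v i) + d *: c + b *: T.
  rewrite zL -sum_scalar_matrix; do 3!congr (_ + _).
  by apply: eq_bigr => i _; apply: eq_bigr => j _; rewrite mE.
have [aME hE] := corner_w zL' zM (center_block H zC (blockw H 0)).
exists a, g, h, b, bG, bM.
rewrite (center_diag H zC) zL' zG zM -aGE -aME casimir_swap /casimir.
(* With [h = 2 (g - d) + d], the corner at [lam] is what the two Casimir
   elements with coefficients [g] and [h] prescribe. *)
have E : (g - d) *: (\sum_i V i * v i) + d *: c =
    g *: (2%:R *: c - \sum_i V i * v i) + h *: (\sum_i V i * v i - c).
  rewrite !scalerBr scalerA [h *: _ - _]addrC addrACA [- (g *: _) + _]addrC.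
  rewrite -!scalerBl addrC.
  by rewrite hE; congr (_ *: _ + _ *: _); ring.
rewrite -[t + _ - _]addrA -[s - c + _]addrA [- c + _]addrC !(scalerDr _ t, scalerDr _ s).
rewrite -[a *: _ + _ + d *: c]addrA E -(idem_sum H) !(scalerDr a) !addrA.
by rewrite [LHS](ACl (1*5*8*6*2*9*3*4*7*10)).
Qed.
End Center.

(** * Socles *)

(** A line stable under left multiplication is a simple submodule. *)
Lemma line_in_socle (k : fieldType) (A : algType k) (a z : A) :
  z != 0 -> z * a = z -> (forall y, exists c : k, y * z = c *: z) ->
  @socle A A^o (left_ideal a) z.
Proof.
move=> z0 za zline; exists [:: z : A^o]; last by rewrite big_seq1.
move=> y; rewrite inE => /eqP ->; exists (fun x => exists c : k, x = c *: z).
split; last by exists 1; rewrite scale1r.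
  split; last 1 first.
  - move=> S [S0 Slin] Sz; have [[y1 [Sy1 y10]]|noS] := pselect (exists x, S x /\ x <> 0).
      right=> x [c ->]; have [d dE] := Sz _ Sy1.
      have d0 : d != 0 by apply/eqP => d0; apply: y10; rewrite dE d0 scale0r.
      have -> : c *: z = ((c / d)%:A : A) *: (y1 : A^o) + 0.
        by rewrite addr0 dE -[RHS]/((c / d)%:A * (d *: z)) mulr_algl scalerA divfK.
      exact: Slin.
    by left=> x Sx; apply: contrapT => x0; apply: noS; exists x.
  - split; first by exists 0; rewrite scale0r.
    move=> b x1 x2 [c1 ->] [c2 ->]; have [d dE] := zline b.
    exists (c1 * d + c2); rewrite scalerDl -scalerA -dE.
    by congr (_ + _); apply/esym/scalerAr.
  - by exists z => //; exists 1; rewrite scale1r.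
by move=> x [c ->]; exists (c *: z); rewrite -scalerAl za.
Qed.

Section SocleLines.
Variables (k : fieldType) (A : algType k) (D : arrows A).
Hypotheses (two_neq0 : 2%:R != 0 :> k) (three_neq0 : 3%:R != 0 :> k).
Hypotheses (H : relations D) (genD : generated D).
Hypotheses (tt_neq0 : tau D * tau D != 0) (ss_neq0 : sigma D * sigma D != 0).

Local Notation V := (aV D).
Local Notation v := (av D).
Local Notation W := (aW D).
Local Notation w := (aw D).
Local Notation t := (tau D).
Local Notation s := (sigma D).
Local Notation c := (kappa D).
Local Notation T := (socL D).

Lemma killed_line r q z : in_block D r q z ->
  (forall i, V i * z = 0) -> (forall i, v i * z = 0) ->
  (forall i, W i * z = 0) -> (forall i, w i * z = 0) ->
  forall y, exists a : k, y * z = a *: z.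
Proof.
move=> zb Vz vz Wz wz; apply: genD => [|a x y [cx xz] [cy yz]|g x Dg [cx xz]].
- by exists 1; rewrite mul1r scale1r.
- by exists (a * cx + cy); rewrite mulrDl -scalerAl xz yz scalerA scalerDl.
suff [cg gz] : exists a : k, g * z = a *: z.
  by exists (cx * cg); rewrite -mulrA xz -scalerAr gz scalerA.
case: Dg => [p|i|i|i|i]; last by [exists 0; rewrite wz scale0r].
- exists (p == r)%:R; rewrite (idem_block H p zb).
  by case: ifP; rewrite ?scale1r ?scale0r.
- by exists 0; rewrite Vz scale0r.
- by exists 0; rewrite vz scale0r.
- by exists 0; rewrite Wz scale0r.
Qed.

(** As the socle is a line by hypothesis, any nonzero element of the ideal
    that all arrows kill must span it. *)
Lemma socle_scalar r q z z0 : in_block D r q z -> z != 0 ->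
  (forall i, V i * z = 0) -> (forall i, v i * z = 0) ->
  (forall i, W i * z = 0) -> (forall i, w i * z = 0) ->
  spans_socle (idem D q) z0 -> exists2 a : k, a != 0 & z0 = a *: z.
Proof.
move=> zb zn0 Vz vz Wz wz [_ z0P].
have /z0P [a za] : @socle A A^o (left_ideal (idem D q)) z.
  by apply: line_in_socle (proj2 zb) _ => //; apply: killed_line zb _ _ _ _.
have a0 : a != 0 by apply: contraNneq zn0 => a0; rewrite za a0 scale0r.
by exists a^-1; rewrite ?invr_eq0 // za scalerA mulVf // scale1r.
Qed.

Lemma socle_gam z : spans_socle (idem D gam) z -> exists2 a : k, a != 0 & z = a *: (t * t).
Proof.
have bt := block_tau H; have btt := block_mul bt bt.
apply: (socle_scalar btt) => // i.
- by rewrite mulrA (mulVtt two_neq0 H).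
- by apply: (mul_block0 H (blockv H i) btt); apply/eqP.
- by apply: (mul_block0 H (blockW H i) btt); apply/eqP.
- by apply: (mul_block0 H (blockw H i) btt); apply/eqP.
Qed.

(** If [socL] vanished, all arrows would kill [tau * v 0] and [tau * v 1]; both
    would span the socle, yet right multiplication by [V 0] kills only the
    second. *)
Lemma socL_neq0 z : spans_socle (idem D lam) z -> T != 0.
Proof.
move=> zsoc; apply/eqP => T0.
have bt := block_tau H; have btv i := block_mul bt (blockv H i).
have tvV i j : t * v i * V j = if i == j then t * t else 0.
  by rewrite -mulrA (mulvV H); case: ifP; rewrite ?mulr0.
have line i : exists2 a : k, a != 0 & z = a *: (t * v i).
  apply: (socle_scalar (btv i)) => [|j|j|j|j|//].
  - by apply: contraNneq tt_neq0 => tv0; have := tvV i i; rewrite eqxx tv0 mul0r => <-.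
  - by rewrite mulrA (mulVtv two_neq0 H) T0; case: ifP.
  - by apply: (mul_block0 H (blockv H j) (btv i)); apply/eqP.
  - by apply: (mul_block0 H (blockW H j) (btv i)); apply/eqP.
  - by apply: (mul_block0 H (blockw H j) (btv i)); apply/eqP.
have [a a0 za] := line 0; have [b b0 zb] := line ord_max.
have /eqP := congr1 (fun x => x * V 0) za; rewrite zb -!scalerAl !tvV eqxx /=.
by rewrite scaler0 eq_sym scaler_eq0 (negPf a0) (negPf tt_neq0).
Qed.

Lemma socle_lam z : spans_socle (idem D lam) z -> exists2 a : k, a != 0 & z = a *: T.
Proof.
move=> zsoc; have bT := block_socL H.
apply: (socle_scalar bT) (zsoc) => [|i|i|i|i]; first exact: socL_neq0 zsoc.
- by apply: (mul_block0 H (blockV H i) bT); apply/eqP.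
- exact: (mulv_socL two_neq0 H).
- exact: (mulW_socL two_neq0 H).
- by apply: (mul_block0 H (blockw H i) bT); apply/eqP.
Qed.

(** * The basis of the centre *)

Lemma sum_ord6 (c : 'I_6 -> k) (x0 x1 x2 x3 x4 x5 : A) :
  \sum_i c i *: tnth [tuple x0; x1; x2; x3; x4; x5] i =
  c 0 *: x0 + c 1 *: x1 + c 2%:R *: x2 + c 3%:R *: x3 + c 4%:R *: x4 + c 5%:R *: x5.
Proof.
rewrite !big_ord_recl big_ord0 addr0 !addrA !(tnth_nth 0) /=.
by congr (_ + _ + _ + _ + _ + _); congr (c _ *: _); apply: val_inj.
Qed.

Lemma three_casimir :
  3%:R *: t - \sum_i V i * v i + 2%:R *: (\sum_i w i * W i) = 3%:R *: casimir D.
Proof.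
rewrite (sumwW H) /casimir; set S := \sum_i _.
rewrite !(scalerBr, scalerDr) !scalerA [3%:R * _]mulrC addrA addrAC.
rewrite -[_ *: t - _ - _]addrA -opprD [2%:R *: S]scaler_nat -mulrS.
by rewrite -scaler_nat addrAC.
Qed.

Lemma idem_gam_casimir : idem D gam * casimir D = t.
Proof.
rewrite /casimir mulrBr mulrDr (block_tau H).1 -scalerAr.
rewrite (idem_block H _ (block_kappa H)) (idem_block H _ (block_sumVv H)).
by rewrite (_ : (gam == lam) = false) ?scaler0 ?addr0 ?subr0 //; apply/eqP.
Qed.

Lemma idem_gam_casimir_swap : idem D gam * casimir (swap D) = 0.
Proof.
rewrite (casimir_swap H) mulrDr mulrBr (idem_block H _ (block_sigma H)).
rewrite (idem_block H _ (block_kappa H)) (idem_block H _ (block_sumVv H)).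
rewrite (_ : (gam == lam) = false); last by apply/eqP.
by rewrite (_ : (gam == mu) = false) ?subr0 ?addr0 //; apply/eqP.
Qed.

(** Multiplication by [idem D gam] sends the six elements to [idem D gam], 0, 0,
    [tau * tau], 0 and [tau]. *)
Lemma free_gam a0 a1 a2 a3 a4 a5 :
  a0 *: 1 + a1 *: T + a2 *: (s * s) + a3 *: (t * t) + a4 *: casimir (swap D)
    + a5 *: casimir D = 0 -> [/\ a0 = 0, a3 = 0 & a5 = 0].
Proof.
move=> E; have {E} : a0 *: idem D gam + a3 *: (t * t) + a5 *: t = 0.
  have := congr1 (fun x => idem D gam * x) E; rewrite !mulrDr mulr0 -!scalerAr mulr1.
  rewrite (idem_block H _ (block_socL H)) mulrA (idem_block H _ (block_sigma H)).
  rewrite idem_gam_casimir_swap idem_gam_casimir mulrA (block_tau H).1.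
  rewrite (_ : (gam == lam) = false); last by apply/eqP.
  rewrite (_ : (gam == mu) = false); last by apply/eqP.
  by rewrite mul0r !scaler0 !addr0.
move=> E; have [a00 a50] : a0 = 0 /\ a5 = 0.
  apply: (free_tau two_neq0 H tt_neq0).
  have := congr1 (fun x => x * t) E.
  by rewrite !mulrDl mul0r -!scalerAl (tau_cube two_neq0 H) (block_tau H).1 scaler0 addr0.
split=> //; move/eqP: E; rewrite a00 a50 !scale0r add0r addr0 scaler_eq0.
by rewrite (negPf tt_neq0) orbF => /eqP.
Qed.
End SocleLines.

Section Basis.
Variables (k : fieldType) (A : algType k) (D : arrows A).
Hypotheses (two_neq0 : 2%:R != 0 :> k) (three_neq0 : 3%:R != 0 :> k).
Hypotheses (H : relations D) (genD : generated D).
Hypotheses (tt_neq0 : tau D * tau D != 0) (ss_neq0 : sigma D * sigma D != 0).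

Local Notation t := (tau D).
Local Notation s := (sigma D).
Local Notation T := (socL D).

Let H' := relations_swap H.

Lemma center_scale (a : k) (z : A) : center z -> center (a *: z).
Proof. by move=> zC x; rewrite -scalerAl zC scalerAr. Qed.

Lemma free_center_basis a0 a1 a2 a3 a4 a5 : T != 0 ->
  a0 *: 1 + a1 *: T + a2 *: (s * s) + a3 *: (t * t) + a4 *: casimir (swap D)
    + a5 *: casimir D = 0 ->
  [/\ a0 = 0, a1 = 0 & a2 = 0] /\ [/\ a3 = 0, a4 = 0 & a5 = 0].
Proof.
move=> T0 E; have [a00 a30 a50] := free_gam two_neq0 H tt_neq0 E.
have [_ a20 a40] : [/\ a0 = 0, a2 = 0 & a4 = 0].
  apply: (@free_gam _ _ (swap D) two_neq0 H' ss_neq0 a0 a1 a3 a2 a5 a4).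
  rewrite (socL_swap two_neq0 H) -[RHS]E /=.
  by rewrite [LHS](ACl (1*2*4*3*6*5)).
split; split=> //; move/eqP: E.
rewrite a00 a20 a30 a40 a50 !scale0r !addr0 add0r scaler_eq0 (negPf T0) orbF.
by move/eqP.
Qed.

Lemma center_basis z_lam z_mu z_gam :
  spans_socle (idem D lam) z_lam -> spans_socle (idem D mu) z_mu ->
  spans_socle (idem D gam) z_gam ->
  is_basis (@center A) [tuple 1; z_lam; z_mu; z_gam;
    3%:R *: casimir (swap D); 3%:R *: casimir D].
Proof.
move=> Sl Sm Sg.
have T0 := socL_neq0 two_neq0 H genD tt_neq0 Sl.
have [l l0 ->] := socle_lam two_neq0 H genD tt_neq0 Sl.
have [m m0 ->] := @socle_gam _ _ (swap D) two_neq0 H' (generated_swap genD) ss_neq0 _ Sm.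
have [g g0 ->] := socle_gam two_neq0 H genD tt_neq0 Sg.
split=> [i|a|x xC].
- case: i => [[|[|[|[|[|[|i]]]]]] Hi] //; rewrite (tnth_nth 0) /=;
    do ?apply: center_scale.
  + by move=> x; rewrite mul1r mulr1.
  + exact: socL_central.
  + exact: (tautau_central two_neq0 H' (generated_swap genD)).
  + exact: tautau_central.
  + exact: (casimir_central two_neq0 H' (generated_swap genD)).
  + exact: casimir_central.
- rewrite sum_ord6 !scalerA => /(free_center_basis T0) [[z0 z1 z2] [z3 z4 z5]].
  have cancel (b d : k) : d != 0 -> b * d = 0 -> b = 0.
    by move=> /negPf d0 /eqP; rewrite mulf_eq0 d0 orbF => /eqP.
  move: (cancel _ _ l0 z1) (cancel _ _ m0 z2) (cancel _ _ g0 z3)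
    (cancel _ _ three_neq0 z4) (cancel _ _ three_neq0 z5) => {}z1 {}z2 {}z3 {}z4 {}z5.
  case=> [[|[|[|[|[|[|i]]]]]] Hi] //;
    [rewrite -[RHS]z0|rewrite -[RHS]z1|rewrite -[RHS]z2|rewrite -[RHS]z3
    |rewrite -[RHS]z4|rewrite -[RHS]z5]; congr (a _); exact: val_inj.
- have [a [b [d [bL [bG [bM ->]]]]]] := center_span two_neq0 H genD tt_neq0 ss_neq0 xC.
  exists (fun i => nth 0 [:: a; bL / l; bM / m; bG / g; d / 3%:R; b / 3%:R] i).
  rewrite sum_ord6 /= !scalerA !divfK //.
  by rewrite [LHS](ACl (1*4*6*5*3*2)).
Qed.

End Basis.

(** * A module on which the square of tau does not vanish *)

Section IntegerMatrices.
Variable k : fieldType.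
Implicit Types f g h : nat -> nat -> int.

(** Matrices over [k] given by integer tables, so that identities between them
    can be checked by computing with integers, whatever the field. *)
Definition int_mx f : 'M[k]_12 := \matrix_(i, j) (f i j)%:~R.

Definition mul_table f g r c : int :=
  foldr (fun l x => f r l * g l c + x) 0 (iota 0 12).
Definition add_table f g r c : int := f r c + g r c.
Definition opp_table f r c : int := - f r c.
Definition eq_table f g :=
  all (fun r => all (fun c => f r c == g r c) (iota 0 12)) (iota 0 12).

Lemma eq_int_mx f g : eq_table f g -> int_mx f = int_mx g.
Proof.
move=> fg; apply/matrixP => i j; rewrite !mxE; congr (_ %:~R).
have i12 : val i \in iota 0 12 by rewrite mem_iota ltn_ord.
have j12 : val j \in iota 0 12 by rewrite mem_iota ltn_ord.
exact/eqP/(allP (allP fg _ i12) _ j12).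
Qed.

Lemma int_mxM f g : int_mx f * int_mx g = int_mx (mul_table f g).
Proof.
apply/matrixP => i j; rewrite !mxE /mul_table.
under eq_bigr do rewrite !mxE.
rewrite -(big_mkord xpredT (fun l => (f i l)%:~R * (g l j)%:~R)) /index_iota subn0.
elim: (iota 0 12) => [|l r IH] /=; first by rewrite big_nil.
by rewrite big_cons IH -intrM -intrD.
Qed.

Lemma int_mxD f g : int_mx f + int_mx g = int_mx (add_table f g).
Proof. by apply/matrixP => i j; rewrite !mxE -intrD. Qed.

Lemma int_mxN f : - int_mx f = int_mx (opp_table f).
Proof. by apply/matrixP => i j; rewrite !mxE -rmorphN. Qed.

Lemma int_mx0 : int_mx (fun _ _ => 0) = 0.
Proof. by apply/matrixP => i j; rewrite !mxE. Qed.

Lemma int_mx1 : int_mx (fun r c => (r == c)%:Z) = 1.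
Proof. by apply/matrixP => i j; rewrite !mxE -val_eqE; case: eqP. Qed.

Lemma ord3_check (P : nat -> nat -> bool) :
  all (fun a => all (P a) (iota 0 3)) (iota 0 3) -> forall i j : 'I_3, P i j.
Proof.
move=> PP i j; have i3 : val i \in iota 0 3 by rewrite mem_iota ltn_ord.
have j3 : val j \in iota 0 3 by rewrite mem_iota ltn_ord.
exact: (allP (allP PP _ i3) _ j3).
Qed.

End IntegerMatrices.

Definition table (pos neg : seq (nat * nat)) (r c : nat) : int :=
  ((r, c) \in pos)%:Z - ((r, c) \in neg)%:Z.

Definition nxt (i : nat) := (i.+1 %% 3)%N.
Definition nxt2 (i : nat) := (i.+2 %% 3)%N.

(** With [U] of basis [u_0, u_1, u_2], the model is the module with component
    k[t]/(t^3) at [gam], U (x) k[t]/(t^2) at [lam] and the exterior square of [U]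
    at [mu]: [V i] sends f to u_i f, [v i] sends u_j f to delta_ij t f, [W i] sends
    u_j f to f(0) u_i /\ u_j, and [w i] is t times the contraction by the i-th
    coordinate.  Rows and columns 0..2 are 1, t, t^2; 3..5 are the u_i; 6..8 are
    the t u_i; and 9 + i is u_(i+1) /\ u_(i+2), indices modulo 3. *)
Definition idem_table (q : vertex) : nat -> nat -> int :=
  table (match q with
         | gam => [:: (0, 0); (1, 1); (2, 2)]
         | lam => [:: (3, 3); (4, 4); (5, 5); (6, 6); (7, 7); (8, 8)]
         | mu => [:: (9, 9); (10, 10); (11, 11)] end)%N [::].
Definition V_table (i : nat) := table [:: (3 + i, 0); (6 + i, 1)]%N [::].
Definition v_table (i : nat) := table [:: (1, 3 + i); (2, 6 + i)]%N [::].
Definition W_table (i : nat) :=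
  table [:: (9 + nxt2 i, 3 + nxt i)]%N [:: (9 + nxt i, 3 + nxt2 i)]%N.
Definition w_table (i : nat) :=
  table [:: (6 + nxt i, 9 + nxt2 i)]%N [:: (6 + nxt2 i, 9 + nxt i)]%N.
Definition tau_table := table [:: (1, 0); (2, 1)]%N [::].
Definition kappa_table := table [:: (6, 3); (7, 4); (8, 5)]%N [::].

(** [sigma] acts as 0, since W kills multiples of t. *)
Definition model (k : fieldType) : arrows 'M[k]_12 := Arrows
  (fun q => int_mx k (idem_table q))
  (fun i => int_mx k (V_table i)) (fun i => int_mx k (v_table i))
  (fun i => int_mx k (W_table i)) (fun i => int_mx k (w_table i))
  (int_mx k tau_table) 0 (int_mx k kappa_table).

Lemma model_relations (k : fieldType) : relations (model k).
Proof.
split=> [r q||i|i|i|i|i j|i j|i j|i j|i j] /=; rewrite -?int_mx0 -?int_mx1.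
- have -> : (if r == q then int_mx k (idem_table r) else int_mx k (fun _ _ => 0)) =
      int_mx k (if r == q then idem_table r else fun _ _ => 0) by case: ifP.
  rewrite int_mxM; apply: eq_int_mx.
  (* Equality on [vertex] is transported from ['I_3]; this form of it computes. *)
  have -> : (r == q) = (match r, q with lam, lam | gam, gam | mu, mu => true
    | _, _ => false end) by case: eqP => [->|]; [case: q | case: r q => [] [] // []].
  by case: r q => [] []; vm_compute.
- by rewrite !int_mxD; apply: eq_int_mx; vm_compute.
- by split; rewrite int_mxM; apply: eq_int_mx; case: i => [[|[|[|i]]] Hi] //; vm_compute.
- by split; rewrite int_mxM; apply: eq_int_mx; case: i => [[|[|[|i]]] Hi] //; vm_compute.
- by split; rewrite int_mxM; apply: eq_int_mx; case: i => [[|[|[|i]]] Hi] //; vm_compute.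
- by split; rewrite int_mxM; apply: eq_int_mx; case: i => [[|[|[|i]]] Hi] //; vm_compute.
- rewrite -fun_if -val_eqE /= int_mxM; apply: eq_int_mx.
  by apply: (ord3_check (P := fun a b => eq_table (mul_table (v_table a) (V_table b))
            (if a == b then tau_table else fun _ _ => 0))); vm_compute.
- rewrite if_same int_mxM; apply: eq_int_mx.
  by apply: (ord3_check (P := fun a b => eq_table (mul_table (W_table a) (w_table b))
            (fun _ _ => 0))); vm_compute.
- rewrite !int_mxM int_mxN; apply: eq_int_mx.
  by apply: (ord3_check (P := fun a b => eq_table (mul_table (W_table a) (V_table b))
            (opp_table (mul_table (W_table b) (V_table a))))); vm_compute.
- rewrite !int_mxM int_mxN; apply: eq_int_mx.
  by apply: (ord3_check (P := fun a b => eq_table (mul_table (v_table a) (w_table b))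
            (opp_table (mul_table (v_table b) (w_table a))))); vm_compute.
- rewrite -fun_if -val_eqE /= !int_mxM int_mxD; apply: eq_int_mx.
  by apply: (ord3_check (P := fun a b => eq_table
     (add_table (mul_table (V_table a) (v_table b)) (mul_table (w_table b) (W_table a)))
     (if a == b then kappa_table else fun _ _ => 0))); vm_compute.
Qed.

Lemma model_tautau (k : fieldType) : tau (model k) * tau (model k) != 0.
Proof.
(* [tau] sends 1 to t and t to t^2: look at row 2, column 0. *)
rewrite int_mxM; apply/eqP => /matrixP/(_ (@Ordinal 12 2 isT) (@Ordinal 12 0 isT)) /eqP.
rewrite !mxE.
have -> : mul_table tau_table tau_table (@Ordinal 12 2 isT) (@Ordinal 12 0 isT) = 1.
  by vm_compute.
by rewrite oner_eq0.
Qed.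

(** * The free algebra and its universal property *)

Section FreeEval.
Variables (k : fieldType) (X : choiceType) (B : algType k) (h : X -> B).

Definition word_eval (m : {fmonom X}) : B := \prod_(x <- (m : seq X)) h x.

Fact word_eval_mmorphism : mmorphism word_eval.
Proof.
by split=> [x y|]; rewrite /word_eval ?fm1 ?fmM ?big_nil ?big_cat.
Qed.
HB.instance Definition _ := monalg.isMultiplicative.Build _ _ word_eval
  word_eval_mmorphism.

Definition free_eval : free_alg k X -> B := mmap (GRing.in_alg B) word_eval.

HB.instance Definition _ := GRing.Additive.copy free_eval (mmap (GRing.in_alg B) word_eval).

Fact free_eval_monoid : monoid_morphism free_eval.
Proof.
have [M1 M2] : multiplicative free_eval.
  by apply: commr_mmap_is_multiplicative => g m m'; rewrite /GRing.comm /= mulr_algl mulr_algr.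
by split.
Qed.
HB.instance Definition _ := GRing.isMonoidMorphism.Build (free_alg k X) B free_eval
  free_eval_monoid.

Lemma free_eval_gen x : free_eval (free_gen k x) = h x.
Proof. by rewrite /free_eval mmapU /= scale1r mul1r /word_eval fmU big_seq1. Qed.

End FreeEval.

Lemma free_alg_ind (k : fieldType) (X : choiceType) (P : free_alg k X -> Prop) :
  P 1 -> (forall a x y, P x -> P y -> P (a *: x + y)) ->
  (forall x y, P y -> P (free_gen k x * y)) -> forall x, P x.
Proof.
move=> P1 Plin Pgen x.
have P0 : P 0 by rewrite -(addNr (1 : free_alg k X)) -scaleN1r; apply: Plin.
have Pword (s : seq X) : P (<< FMonom s >> : {malg _[_]}).
  elim: s => [|y s IH]; first by rewrite -fmoneE; exact: P1.
  rewrite (_ : << _ >> = free_gen k y * (<< FMonom s >> : {malg _[_]})).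
    exact: Pgen.
  rewrite /free_gen -[RHS]/(fgmul _ _) fgmulUU mulr1; congr << _ >>.
  by rewrite -[RHS]/(fmmul (fmu y) (FMonom s)) fmmulE fmuE.
rewrite [x]monalgE; elim/big_rec: _ => // m y _ Py.
rewrite (_ : << _ *g _ >> = x@_m *: (<< m >> : {malg _[_]})).
  by apply: Plin => //; case: m => s; apply: Pword.
by apply/malgP => n; rewrite mcoeffZ !mcoeffU mulr_natr.
Qed.

(** * The presentation of Lambda *)

Section Weights.
Variables (p : nat) (p_gt0 : (0 < p)%N).

Definition weight (i : 'I_3) : int * int := nth 0 (W p) i.

Lemma weight_W i : weight i \in W p.
Proof. exact: mem_nth. Qed.

Lemma oppW_weights : oppW p = [seq - a | a <- W p].
Proof.
have oppE (x y : int) : - (x, y) = (- x, - y) by [].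
by rewrite /oppW /W /= !oppE !oppr0 !opprK.
Qed.

Lemma weight_oppW i : - weight i \in oppW p.
Proof. by rewrite oppW_weights map_f // weight_W. Qed.

Lemma weightP a : a \in W p -> exists i, a = weight i.
Proof.
move=> aW; have i3 : (index a (W p) < 3)%N by rewrite -[3%N]/(size (W p)) index_mem.
by exists (Ordinal i3); rewrite /weight /= nth_index.
Qed.

Lemma oppweightP a : a \in oppW p -> exists i, a = - weight i.
Proof. by rewrite oppW_weights => /mapP[b /weightP[i ->] ->]; exists i. Qed.

Let p_neq0 : (p%:Z == 0) = false.
Proof. by case: p p_gt0. Qed.

Let p_neqN : (p%:Z == - p%:Z) = false.
Proof. by case: p p_gt0. Qed.

Lemma uniq_W : uniq (W p ++ oppW p).
Proof.
rewrite /= !inE !xpair_eqE !(eq_sym 0) !(eq_sym (- _) p%:Z) !oppr_eq0 p_neq0 p_neqN.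
by rewrite ?andbF ?andFb ?eqxx.
Qed.

Lemma weight_eq i j : (weight i == weight j) = (i == j).
Proof.
rewrite /weight nth_uniq //.
by have := uniq_W; rewrite cat_uniq => /andP[].
Qed.

Lemma oppweight_notin_W i : (- weight i \in W p) = false.
Proof.
have := uniq_W; rewrite cat_uniq => /and3P[_ /hasPn/(_ _ (weight_oppW i)) + _].
by move/negPf.
Qed.

Definition arrows_of (A : nzRingType) (e : vertex -> A) (v w : int * int -> A) : arrows A :=
  Arrows e (fun i => v (weight i)) (fun i => v (- weight i))
    (fun i => w (weight i)) (fun i => w (- weight i))
    (v (- weight 0) * v (weight 0)) (w (weight 0) * w (- weight 0))
    (v (weight 0) * v (- weight 0) + w (- weight 0) * w (weight 0)).

Lemma relations_of_Lambda_rel (A : nzRingType) (e : vertex -> A) (v w : int * int -> A) :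
  (forall l r, Lambda_rel p e v w l r -> l = r) -> relations (arrows_of e v w).
Proof.
move=> rel; have Wi := weight_W; have oi := weight_oppW.
have idE q r := rel _ _ (rel_idem p e v w q r).
have blockE q r x : e q * x * e r = x -> e q * x = x /\ x * e r = x.
  by move=> <-; split; rewrite -?mulrA ?idE ?eqxx // !mulrA idE eqxx.
have oppE i j : (- weight i == - weight j) = (i == j) by rewrite eqr_opp weight_eq.
split=> /= [q r||i|i|i|i|i j|i j|i j|i j|i j].
- exact: idE.
- by apply: rel; apply: Defs.rel_unit.
- by apply/blockE/rel; apply: rel_v_W.
- by apply/blockE/rel; apply: rel_v_oppW.
- by apply/blockE/rel; apply: rel_w_W.
- by apply/blockE/rel; apply: rel_w_oppW.
- case: (eqVneq i j) => [->|ij].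
    by have := rel _ _ (rel_vv e v w (oi j) (oi 0)); rewrite !opprK.
  by rewrite -[weight j]opprK; apply: rel; apply: rel_vv0; rewrite ?oppE.
- case: (eqVneq i j) => [->|ij].
    by have := rel _ _ (rel_ww e v w (oi j) (oi 0)); rewrite !opprK.
  by rewrite -[weight i]opprK; apply: rel; apply: rel_ww0; rewrite ?oppE.
- apply/eqP; rewrite -addr_eq0; apply/eqP.
  by have := rel _ _ (rel_wv e v w (oi i) (oi j)); rewrite !opprK.
- apply/eqP; rewrite -addr_eq0; apply/eqP.
  by apply: rel; apply: rel_vw.
- case: (eqVneq i j) => [->|ij].
    by have := rel _ _ (rel_vvww e v w (oi j) (oi 0)); rewrite !opprK.
  by have := rel _ _ (rel_vvww0 e v w (oi i) (oi j) _); rewrite !opprK oppE; apply.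
Qed.

Lemma Lambda_rel_of_relations (A : nzRingType) (D : arrows A) e v w :
  relations D -> (forall q, e q = idem D q) ->
  (forall i, v (weight i) = aV D i) -> (forall i, v (- weight i) = av D i) ->
  (forall i, w (weight i) = aW D i) -> (forall i, w (- weight i) = aw D i) ->
  forall l r, Lambda_rel p e v w l r -> l = r.
Proof.
move=> H Ee EV Ev EW Ew l r; have oppE i j : (- weight i == - weight j) = (i == j).
  by rewrite eqr_opp weight_eq.
case=> [q q'||a /weightP[i ->]|a /oppweightP[i ->]|a /weightP[i ->]|a /oppweightP[i ->]
  |a b /oppweightP[i ->] /oppweightP[j ->]|a b /oppweightP[i ->] /oppweightP[j ->]
  |a b /oppweightP[i ->] /oppweightP[j ->]|a b /oppweightP[i ->] /oppweightP[j ->]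
  |a b /oppweightP[i ->] /oppweightP[j ->]|a b /oppweightP[i ->] /oppweightP[j ->]
  |a b /oppweightP[i ->] /oppweightP[j ->]|a b /oppweightP[i ->] /oppweightP[j ->]];
  rewrite ?opprK ?oppE ?(EV, Ev, EW, Ew, Ee).
- exact: idem_mul.
- exact: idem_sum.
- by have [-> ->] := blockV H i.
- by have [-> ->] := blockv H i.
- by have [-> ->] := blockW H i.
- by have [-> ->] := blockw H i.
- by move=> /negPf ij; rewrite (mulvV H) ij.
- by rewrite !(mulvV H) !eqxx.
- by move=> /negPf ij; rewrite (mulWw H) ij.
- by rewrite !(mulWw H) !eqxx.
- by rewrite (anti_WV H) addNr.
- by rewrite (anti_vw H) addNr.
- by move=> /negPf ij; rewrite (addVv_wW H) ij.
- by rewrite !(addVv_wW H) !eqxx.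
Qed.
End Weights.

Section Transport.
Variables (p : nat) (A B : nzRingType) (f : {rmorphism A -> B}).
Variables (e : vertex -> A) (v w : int * int -> A).

Lemma Lambda_rel_image l r :
  Lambda_rel p e v w l r -> Lambda_rel p (f \o e) (f \o v) (f \o w) (f l) (f r).
Proof.
case=> [q q'||a Wa|a Wa|a Wa|a Wa|a b Wa Wb ab|a b Wa Wb|a b Wa Wb ab|a b Wa Wb
  |a b Wa Wb|a b Wa Wb|a b Wa Wb ab|a b Wa Wb];
  rewrite ?(rmorphM, rmorphD, rmorph0, rmorph1) ?(fun_if f) ?rmorph0.
- exact: (rel_idem p (f \o e)).
- exact: (Defs.rel_unit p (f \o e)).
- exact: (rel_v_W (f \o e) (f \o v)).
- exact: (rel_v_oppW (f \o e) (f \o v)).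
- exact: (rel_w_W (f \o e) _ (f \o w)).
- exact: (rel_w_oppW (f \o e) _ (f \o w)).
- exact: (rel_vv0 _ (f \o v)).
- exact: (rel_vv _ (f \o v)).
- exact: (rel_ww0 _ _ (f \o w)).
- exact: (rel_ww _ _ (f \o w)).
- exact: (rel_wv _ (f \o v) (f \o w)).
- exact: (rel_vw _ (f \o v) (f \o w)).
- exact: (rel_vvww0 _ (f \o v) (f \o w)).
- exact: (rel_vvww _ (f \o v) (f \o w)).
Qed.

(** Each relation between images is the image of a relation. *)
Lemma Lambda_rel_descent :
  (forall l r, Lambda_rel p e v w l r -> f l = f r) ->
  forall l r, Lambda_rel p (f \o e) (f \o v) (f \o w) l r -> l = r.
Proof.
move=> fE l r; case=> [q q'||a Wa|a Wa|a Wa|a Wa|a b Wa Wb ab|a b Wa Wb|a b Wa Wb ab|a b Wa Wb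
  |a b Wa Wb|a b Wa Wb|a b Wa Wb ab|a b Wa Wb] /=.
- by have := fE _ _ (rel_idem p e v w q q'); rewrite rmorphM (fun_if f) rmorph0.
- by have := fE _ _ (Defs.rel_unit p e v w); rewrite !rmorphD rmorph1.
- by have := fE _ _ (rel_v_W e v w Wa); rewrite !rmorphM.
- by have := fE _ _ (rel_v_oppW e v w Wa); rewrite !rmorphM.
- by have := fE _ _ (rel_w_W e v w Wa); rewrite !rmorphM.
- by have := fE _ _ (rel_w_oppW e v w Wa); rewrite !rmorphM.
- by have := fE _ _ (rel_vv0 e v w Wa Wb ab); rewrite rmorphM rmorph0.
- by have := fE _ _ (rel_vv e v w Wa Wb); rewrite !rmorphM.
- by have := fE _ _ (rel_ww0 e v w Wa Wb ab); rewrite rmorphM rmorph0.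
- by have := fE _ _ (rel_ww e v w Wa Wb); rewrite !rmorphM.
- by have := fE _ _ (rel_wv e v w Wa Wb); rewrite rmorphD !rmorphM rmorph0.
- by have := fE _ _ (rel_vw e v w Wa Wb); rewrite rmorphD !rmorphM rmorph0.
- by have := fE _ _ (rel_vvww0 e v w Wa Wb ab); rewrite rmorphD !rmorphM rmorph0.
- by have := fE _ _ (rel_vvww e v w Wa Wb); rewrite !rmorphD !rmorphM.
Qed.
End Transport.

Section LambdaAlgebra.
Variables (k : fieldType) (p : nat) (p_gt0 : (0 < p)%N).

Local Notation pr := (ProperRel (@Lambda_rel_proper k p)).
Local Notation pi := (quot_pi pr).

Definition Lambda_arrows : arrows (Lambda k p) :=
  arrows_of p e (@Defs.v k p) (@Defs.w k p).

Lemma Lambda_rel_quot l r : Lambda_rel p (gen_e k p) (gen_v k p) (gen_w k p) l r ->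
  pi l = pi r.
Proof.
move=> lr; apply/quot_piE; rewrite -[_ - _]addr0 -[l - r]mulr1 -[l - r]mul1r.
exact/ideal_ofD/ideal_of0.
Qed.

Lemma Lambda_rel_holds l r : Lambda_rel p e (@Defs.v k p) (@Defs.w k p) l r -> l = r.
Proof. exact: (Lambda_rel_descent (f := pi) Lambda_rel_quot). Qed.

Lemma Lambda_relations : relations Lambda_arrows.
Proof. exact/relations_of_Lambda_rel/Lambda_rel_holds. Qed.

Lemma gen_v_val (i : wt p) : gen_v k p (val i) = free_gen k (inr (inl i) : gen p).
Proof. by rewrite /gen_v valK. Qed.

Lemma gen_w_val (i : wt p) : gen_w k p (val i) = free_gen k (inr (inr i) : gen p).
Proof. by rewrite /gen_w valK. Qed.

Lemma wt_weight (a : wt p) : exists i, val a = weight p i \/ val a = - weight p i.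
Proof.
have : val a \in W p ++ oppW p by exact: svalP a.
rewrite mem_cat => /orP[/weightP[i ->]|/oppweightP[i ->]]; exists i; by [left | right].
Qed.

Lemma Lambda_generated : generated Lambda_arrows.
Proof.
move=> P P1 Plin Pgen x.
have -> : x = pi (repr (x : {ideal_quot (ideal_pred pr)})) by rewrite /quot_pi reprK.
move: (repr _) => y; elim/free_alg_ind: y => [|a y z Py Pz|g y Py].
- by rewrite rmorph1.
- rewrite rmorphD /= (_ : pi (a *: y) = a *: pi y); last exact: linearZ.
  exact: Plin.
rewrite rmorphM; apply: Pgen => //.
case: g => [q|[a|a]]; first exact: (gen_idem Lambda_arrows).
- rewrite -gen_v_val; have [i [->|->]] := wt_weight a.
    exact: (gen_aV Lambda_arrows).
  exact: (gen_av Lambda_arrows).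
- rewrite -gen_w_val; have [i [->|->]] := wt_weight a.
    exact: (gen_aW Lambda_arrows).
  exact: (gen_aw Lambda_arrows).
Qed.

Section Universal.
Variables (B : algType k) (E : arrows B).

Definition assign (X Y : 'I_3 -> B) (a : int * int) : B :=
  if a \in W p then X (inord (index a (W p))) else Y (inord (index (- a) (W p))).

Lemma assign_W X Y i : assign X Y (weight p i) = X i.
Proof.
rewrite /assign weight_W index_uniq ?inord_val //.
by have := uniq_W p_gt0; rewrite cat_uniq => /andP[].
Qed.

Lemma assign_oppW X Y i : assign X Y (- weight p i) = Y i.
Proof.
rewrite /assign oppweight_notin_W // opprK index_uniq ?inord_val //.
by have := uniq_W p_gt0; rewrite cat_uniq => /andP[].
Qed.

Definition gen_image (g : gen p) : B :=
  match g with
  | inl q => idem E q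
  | inr (inl a) => assign (aV E) (av E) (val a)
  | inr (inr a) => assign (aW E) (aw E) (val a)
  end.

Local Notation phi := (free_eval gen_image).

Lemma eval_gen_v a : a \in W p ++ oppW p ->
  phi (gen_v k p a) = assign (aV E) (av E) a.
Proof. by move=> aW; rewrite /gen_v insubT free_eval_gen. Qed.

Lemma eval_gen_w a : a \in W p ++ oppW p ->
  phi (gen_w k p a) = assign (aW E) (aw E) a.
Proof. by move=> aW; rewrite /gen_w insubT free_eval_gen. Qed.

Lemma weight_cat i : weight p i \in W p ++ oppW p.
Proof. by rewrite mem_cat weight_W. Qed.

Lemma oppweight_cat i : - weight p i \in W p ++ oppW p.
Proof. by rewrite mem_cat weight_oppW orbT. Qed.

(** The evaluation respects the relations, so it factors through Lambda: a
    representation can witness that an element of Lambda is not zero. *)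
Lemma eval_kernel x : relations E -> pi x = 0 -> phi x = 0.
Proof.
move=> HE; rewrite -(rmorph0 pi) => /quot_piE; rewrite subr0.
have phiE l r : Lambda_rel p (gen_e k p) (gen_v k p) (gen_w k p) l r -> phi l = phi r.
  move/(Lambda_rel_image phi).
  apply: (Lambda_rel_of_relations p_gt0 HE) => [q|i|i|i|i] /=.
  - exact: free_eval_gen.
  - by rewrite eval_gen_v ?weight_cat // assign_W.
  - by rewrite eval_gen_v ?oppweight_cat // assign_oppW.
  - by rewrite eval_gen_w ?weight_cat // assign_W.
  - by rewrite eval_gen_w ?oppweight_cat // assign_oppW.
elim=> [|a l r b y lr _ IH]; first exact: rmorph0.
by rewrite rmorphD !rmorphM rmorphB /= (phiE _ _ lr) subrr mulr0 mul0r add0r.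
Qed.

Lemma tautau_from_rep : relations E ->
  tau E * tau E != 0 -> tau Lambda_arrows * tau Lambda_arrows != 0.
Proof.
move=> HE; apply: contraNneq => tt0.
pose y := gen_v k p (- weight p 0) * gen_v k p (weight p 0).
have : pi (y * y) = 0 by rewrite !rmorphM.
move/(eval_kernel HE); rewrite !rmorphM /= !eval_gen_v ?weight_cat ?oppweight_cat //.
by rewrite assign_W assign_oppW (mulvV HE) eqxx => ->.
Qed.

Lemma sigmasigma_from_rep : relations E ->
  sigma E * sigma E != 0 -> sigma Lambda_arrows * sigma Lambda_arrows != 0.
Proof.
move=> HE; apply: contraNneq => tt0.
pose y := gen_w k p (weight p 0) * gen_w k p (- weight p 0).
have : pi (y * y) = 0 by rewrite !rmorphM.
move/(eval_kernel HE); rewrite !rmorphM /= !eval_gen_w ?weight_cat ?oppweight_cat //.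
by rewrite assign_W assign_oppW (mulWw HE) eqxx => ->.
Qed.
End Universal.

Lemma Lambda_tautau : tau Lambda_arrows * tau Lambda_arrows != 0.
Proof. exact: tautau_from_rep (model_relations k) (model_tautau k). Qed.

Lemma Lambda_sigmasigma : sigma Lambda_arrows * sigma Lambda_arrows != 0.
Proof.
exact: sigmasigma_from_rep (relations_swap (model_relations k)) (model_tautau k).
Qed.

Lemma sum_W (U : nmodType) (G : int * int -> U) :
  \sum_(a <- W p) G a = \sum_i G (weight p i).
Proof.
by rewrite (big_nth 0) big_mkord.
Qed.

(** The weight of index 2 is (0, -p), so the first term of [z_gamlam] is [3 tau]. *)
Lemma z_gamlamE : z_gamlam k p = 3%:R *: casimir Lambda_arrows.
Proof.
have t3 : Defs.v k p (0, p%:Z) * Defs.v k p (0, - p%:Z) = tau Lambda_arrows.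
  have := mulvV Lambda_relations (@Ordinal 3 2 isT) (@Ordinal 3 2 isT).
  rewrite eqxx => <- /=; congr (Defs.v _ _ _ * Defs.v _ _ _).
  by rewrite /weight /= -[RHS]/(- 0, - - p%:Z) oppr0 opprK.
rewrite -(three_casimir Lambda_relations) -t3.
by congr (_ - _ + _ *: _); exact: sum_W.
Qed.

Lemma z_mulamE : z_mulam k p = 3%:R *: casimir (swap Lambda_arrows).
Proof.
have s3 : Defs.w k p (0, - p%:Z) * Defs.w k p (0, p%:Z) = sigma Lambda_arrows.
  have := mulWw Lambda_relations (@Ordinal 3 2 isT) (@Ordinal 3 2 isT).
  rewrite eqxx => <- /=; congr (Defs.w _ _ _ * Defs.w _ _ _).
  by rewrite /weight /= -[RHS]/(- 0, - - p%:Z) oppr0 opprK.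
rewrite -(three_casimir (relations_swap Lambda_relations)) -[tau _]s3.
by congr (_ - _ + _ *: _); exact: sum_W.
Qed.
End LambdaAlgebra.

Theorem proposition6p1 (k : closedFieldType) (p : nat)
    (hp : p \in [pchar k]) (hp3 : (3 < p)%N)
    (z_lam z_mu z_gam : Lambda k p)
    (h_lam : spans_socle (e lam) z_lam)
    (h_mu : spans_socle (e mu) z_mu)
    (h_gam : spans_socle (e gam) z_gam) :
  is_basis (@center (Lambda k p))
    [tuple 1; z_lam; z_mu; z_gam; z_mulam k p; z_gamlam k p].
Proof.
have p_gt0 : (0 < p)%N by apply: leq_trans hp3.
have small n : (0 < n < p)%N -> n%:R != 0 :> k.
  by move=> /andP[n0 np]; rewrite -(dvdn_pcharf hp) gtnNdvd.
rewrite z_mulamE // z_gamlamE //.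
have two_neq0 : 2%:R != 0 :> k by apply: small; rewrite (ltn_trans _ hp3).
have three_neq0 : 3%:R != 0 :> k by apply: small.
have B := center_basis two_neq0 three_neq0 (Lambda_relations k p_gt0) (@Lambda_generated k p)
  (Lambda_tautau k p_gt0) (Lambda_sigmasigma k p_gt0) h_lam h_mu h_gam.
exact: B.
Qed.
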